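(* For every Euclidean zero-set $\widetilde{\mathcal Z}$ with finite area and every $(\alpha,\beta)\in[0,1]^2$, $$\widetilde I(\alpha,\beta,\widetilde{\mathcal Z})\ge(1-\max(\alpha,\beta))\,\widetilde\gamma(\widetilde{\mathcal Z})$$ and $$\widetilde I(\alpha,\beta,\widetilde{\mathcal Z})\le\min\big((1-\max(\alpha,\beta))\,\mathrm{area}(\widetilde{\mathcal Z}),\ 2(1-\min(\alpha,\beta))\,\widetilde\gamma(\widetilde{\mathcal Z}),\ \widetilde\gamma(\widetilde{\mathcal Z})\big).$$
   Context: $\widetilde R_{a,b}=[0,a]\times[0,b]$. A Euclidean zero-set is a closed $\widetilde{\mathcal Z}\subseteq[0,\infty)^2$ such that $(a,b)\in\widetilde{\mathcal Z}$ implies $\widetilde R_{a,b}\subseteq\widetilde{\mathcal Z}$, and $\widetilde{\mathcal Z}$ is the closure of $\widetilde{\mathcal Z}\cap(0,\infty)^2$. For Borel $A\subseteq[0,\infty)^2$, $\widetilde{\mathrm{row}}(x,A)$ (resp. $\widetilde{\mathrm{col}}(x,A)$) is the 1-dimensional Lebesgue measure of $A$ intersected with the horizontal (resp. vertical) line through $x$. For left-continuous nonincreasing $f,g:[0,\infty)\to[0,\infty)$ of compact support, $\widetilde{\mathcal T}(A)=A\cup\{(u,v):(\widetilde{\mathrm{row}}((u,v),A)+f(v),\widetilde{\mathrm{col}}((u,v),A)+g(u))\notin\widetilde{\mathcal Z}\}$; $A$ E-spans for $(\widetilde{\mathcal Z},f,g)$ if $\bigcup_n\widetilde{\mathcal T}^n(A)=[0,\infty)^2$.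 For bounded $\widetilde{\mathcal Z}$ and $(\alpha,\beta)\in[0,1]^2$: $\widetilde I(\alpha,\beta,\widetilde{\mathcal Z})=\inf\{\mathrm{area}(A)+(1-\alpha)\int_0^\infty f+(1-\beta)\int_0^\infty g\}$ over all $(A,f,g)$ with $A$ compact E-spanning for $(\widetilde{\mathcal Z},f,g)$; for general $\widetilde{\mathcal Z}$, $\widetilde I$ is defined as $\lim_{R\to\infty}$ of the value for $\widetilde{\mathcal Z}\cap[0,R]^2$. $\widetilde\gamma(\widetilde{\mathcal Z})=\widetilde I(0,0,\widetilde{\mathcal Z})$. *)

(* Defs.v *)
From Stdlib Require Import Reals.
Open Scope R_scope.

Definition pt := (R * R)%type.

Definition is_inf (P : R -> Prop) (v : R) : Prop :=
  (forall x, P x -> v <= x) /\ (forall w, (forall x, P x -> w <= x) -> w <= v).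

(* extended nonnegative reals: None = +infinity *)
Definition ereal := option R.

Definition cover_sums1 (S : R -> Prop) (s : R) : Prop :=
  exists a b : nat -> R,
    (forall n, a n <= b n) /\
    (forall x, S x -> exists n, a n <= x <= b n) /\
    infinite_sum (fun n => b n - a n) s.

Definition leb1 (S : R -> Prop) (m : ereal) : Prop :=
  match m with
  | Some r => is_inf (cover_sums1 S) r
  | None => forall s, ~ cover_sums1 S s
  end.

Definition cover_sums2 (S : pt -> Prop) (s : R) : Prop :=
  exists a b c d : nat -> R,
    (forall n, a n <= b n /\ c n <= d n) /\
    (forall p, S p -> exists n, a n <= fst p <= b n /\ c n <= snd p <= d n) /\
    infinite_sum (fun n => (b n - a n) * (d n - c n)) s.

Definition leb2 (S : pt -> Prop) (m : ereal) : Prop :=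
  match m with
  | Some r => is_inf (cover_sums2 S) r
  | None => forall s, ~ cover_sums2 S s
  end.

Definition quadrant (p : pt) : Prop := 0 <= fst p /\ 0 <= snd p.

(* sup-norm distance (topologically equivalent to the Euclidean one) *)
Definition near (p q : pt) (eps : R) : Prop :=
  Rabs (fst p - fst q) < eps /\ Rabs (snd p - snd q) < eps.

Definition is_closed (S : pt -> Prop) : Prop :=
  forall p, (forall eps, 0 < eps -> exists q, S q /\ near p q eps) -> S p.

Definition is_bounded (S : pt -> Prop) : Prop :=
  exists M, forall p, S p -> Rabs (fst p) <= M /\ Rabs (snd p) <= M.

Definition is_compact (S : pt -> Prop) : Prop := is_closed S /\ is_bounded S.

Definition zero_set (Z : pt -> Prop) : Prop :=
  is_closed Z /\
  (forall p, Z p -> quadrant p) /\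
  (forall a b u v, Z (a, b) -> 0 <= u <= a -> 0 <= v <= b -> Z (u, v)) /\
  (forall p, Z p <->
     (forall eps, 0 < eps -> exists q, Z q /\ 0 < fst q /\ 0 < snd q /\ near p q eps)).

Definition admissible (f : R -> R) : Prop :=
  (forall x, 0 <= x -> 0 <= f x) /\
  (forall x y, 0 <= x <= y -> f y <= f x) /\
  (forall x, 0 < x -> forall eps, 0 < eps ->
     exists d, 0 < d /\ forall y, 0 <= y -> x - d < y <= x -> Rabs (f y - f x) < eps) /\
  (exists M, forall x, M <= x -> f x = 0).

(* the integral ∫_0^∞ f, as the Lebesgue measure of the region under the graph *)
Definition subgraph (f : R -> R) (p : pt) : Prop :=
  0 <= fst p /\ 0 <= snd p /\ snd p < f (fst p).

Definition row_set (p : pt) (A : pt -> Prop) : R -> Prop := fun x => A (x, snd p).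
Definition col_set (p : pt) (A : pt -> Prop) : R -> Prop := fun y => A (fst p, y).

Definition Tstep (Z : pt -> Prop) (f g : R -> R) (A : pt -> Prop) : pt -> Prop :=
  fun p => A p \/
    (quadrant p /\
     ~ (exists r c, leb1 (row_set p A) (Some r) /\ leb1 (col_set p A) (Some c) /\
                    Z (r + f (snd p), c + g (fst p)))).

Fixpoint Titer (Z : pt -> Prop) (f g : R -> R) (n : nat) (A : pt -> Prop) : pt -> Prop :=
  match n with
  | O => A
  | S k => Tstep Z f g (Titer Z f g k A)
  end.

Definition E_spans (Z : pt -> Prop) (f g : R -> R) (A : pt -> Prop) : Prop :=
  forall p, quadrant p <-> exists n, Titer Z f g n A p.

Definition I_values (alpha beta : R) (Z : pt -> Prop) (x : R) : Prop :=
  exists (A : pt -> Prop) (f g : R -> R) (aA iF iG : R),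
    admissible f /\ admissible g /\
    is_compact A /\ (forall p, A p -> quadrant p) /\
    E_spans Z f g A /\
    leb2 A (Some aA) /\ leb2 (subgraph f) (Some iF) /\ leb2 (subgraph g) (Some iG) /\
    x = aA + (1 - alpha) * iF + (1 - beta) * iG.

Definition I_bounded (alpha beta : R) (Z : pt -> Prop) (v : R) : Prop :=
  is_inf (I_values alpha beta Z) v.

Definition truncate (Z : pt -> Prop) (R0 : R) : pt -> Prop :=
  fun p => Z p /\ fst p <= R0 /\ snd p <= R0.

Definition I_tilde (alpha beta : R) (Z : pt -> Prop) (L : R) : Prop :=
  forall eps, 0 < eps -> exists R0, forall Rr, R0 <= Rr ->
    exists v, I_bounded alpha beta (truncate Z Rr) v /\ Rabs (v - L) < eps.

Definition gamma_tilde (Z : pt -> Prop) (G : R) : Prop := I_tilde 0 0 Z G.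

(* Main.v *)
(* The lower bound and [I <= gamma] compare the costs of one and the same triple (A, f, g).

   For the area bound take A empty, g = 0 and for f the row profile of the zero-set
   thickened by e: once the rows below height c are full, the rows below c + e fill up.

   For [I <= 2 (1 - min) gamma], cover A and the hypographs of f and g by finitely many
   rectangles.  The row lengths of A plus f are bounded by a simple function phi, the column
   lengths of A plus g by psi, with total integral at most 2 area(A) + int f + int g + eps.
   Whether a point outside A is ever added is governed by a process on the pairs
   (phi v, psi u) that depends on phi and psi only through their distributions, so the
   decreasing rearrangements of phi and psi span with empty initial set.

   The truncated values increase with the truncation radius, so the limit is a supremum. *)

From Coquelicot Require Import Rcomplements Compactness.
From Stdlib Require Import Reals Lra Lia List Classical ClassicalEpsilon.
Require Import Defs.
Import ListNotations.
Open Scope R_scope.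

(** Measurability is never established. The proof treats [leb1] and [leb2] as outer measures: it
    works with monotonicity, finite subadditivity and the fact that [0, L) has length at least L. So
    no Fubini theorem links the area of A to the lengths of its rows. Compactness replaces it: a
    finite rectangle cover of A has explicit row and column lengths, and each of these two step
    functions integrates exactly to the total area of the rectangles. A is thus charged once for
    rows and once for columns, which is the origin of the factor 2.

    The thickening by e is forced by the closedness of the zero-set: a point is added only if its
    pair lies outside Z. With the exact profile f of a nonempty compact Z and g = 0, nothing would
    ever be added to the empty set, because (f(v), 0) lies in Z for every v. The thickened profile
    exceeds the closed set and gains a fixed height in every round. *)

Definition interval := (R * R)%type.
Definition rect := (interval * interval)%type.

Definition ilen (i : interval) : R := snd i - fst i.
Definition in_int (i : interval) (x : R) : Prop := fst i <= x <= snd i.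
Definition in_rect (r : rect) (p : pt) : Prop :=
  in_int (fst r) (fst p) /\ in_int (snd r) (snd p).
Definition area (r : rect) : R := ilen (fst r) * ilen (snd r).
Definition proper_int (i : interval) : Prop := fst i <= snd i.
Definition proper_rect (r : rect) : Prop := proper_int (fst r) /\ proper_int (snd r).

Fixpoint sumR {T : Type} (F : T -> R) (l : list T) : R :=
  match l with
  | [] => 0
  | x :: l' => F x + sumR F l'
  end.

Definition int_cover (l : list interval) (S : R -> Prop) : Prop :=
  forall x, S x -> exists i, In i l /\ in_int i x.
Definition rect_cover (l : list rect) (S : pt -> Prop) : Prop :=
  forall p, S p -> exists r, In r l /\ in_rect r p.

Lemma sumR_app {T} (F : T -> R) l1 l2 : sumR F (l1 ++ l2) = sumR F l1 + sumR F l2.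
Proof. induction l1 as [|x l1 IH]; simpl; [lra | rewrite IH; lra]. Qed.

Lemma sumR_map {T U} (F : U -> R) (h : T -> U) l :
  sumR F (map h l) = sumR (fun x => F (h x)) l.
Proof. induction l as [|x l IH]; simpl; [reflexivity | now rewrite IH]. Qed.

Lemma sumR_ext {T} (F G : T -> R) l :
  (forall x, F x = G x) -> sumR F l = sumR G l.
Proof. intros H. induction l as [|x l IH]; simpl; [reflexivity | now rewrite IH, H]. Qed.

Lemma sumR_nonneg {T} (F : T -> R) l :
  (forall x, In x l -> 0 <= F x) -> 0 <= sumR F l.
Proof.
  intros H. induction l as [|x l IH]; simpl; [lra|].
  assert (0 <= F x) by (apply H; left; reflexivity).
  assert (0 <= sumR F l) by (apply IH; intros; apply H; right; assumption). lra.
Qed.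

(** * Finite subcovers of compact sets and lengths of finite interval covers *)

Lemma finite_subcover (S : pt -> Prop) (a b c d : nat -> R) :
  is_compact S ->
  (forall p, S p -> exists n, a n < fst p < b n /\ c n < snd p < d n) ->
  exists N, forall p, S p ->
    exists n, (n < N)%nat /\ a n < fst p < b n /\ c n < snd p < d n.
Proof.
  intros [Hcl [M HM]] Hcov.
  (* A gauge on the whole plane: at a point of [S] the radius is the margin inside some covering
     open rectangle; at a point off the closed set [S] it is a radius whose square misses [S], so
     that the claim is vacuous there. Gauge compactness of the square leaves finitely many
     indices. *)
  assert (Hg : forall t : Compactness.Tn 2 R, exists nr : nat * posreal,
    forall x y, Rabs (x - fst t) < snd nr -> Rabs (y - fst (snd t)) < snd nr -> S (x, y) ->
      a (fst nr) < x < b (fst nr) /\ c (fst nr) < y < d (fst nr)).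
  { intros [u [v []]]. simpl.
    destruct (classic (S (u, v))) as [HS | HS].
    - destruct (Hcov _ HS) as [n [[H1 H2] [H3 H4]]]. simpl in *.
      set (r := Rmin (Rmin (u - a n) (b n - u)) (Rmin (v - c n) (d n - v))).
      assert (Hr : 0 < r) by (unfold r; repeat apply Rmin_glb_lt; lra).
      exists (n, mkposreal r Hr). simpl. intros x y Hx Hy _.
      assert (r <= u - a n /\ r <= b n - u /\ r <= v - c n /\ r <= d n - v) as (?&?&?&?).
      { unfold r, Rmin. repeat destruct Rle_dec; lra. }
      apply Rabs_def2 in Hx. apply Rabs_def2 in Hy. lra.
    - assert (Hn : exists eps, 0 < eps /\ forall q, S q -> ~ near (u, v) q eps).
      { apply NNPP. intros Hn. apply HS, Hcl. intros eps He.
        apply NNPP. intros Hq. apply Hn. exists eps. split; [exact He|].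
        intros q Sq Nq. apply Hq. exists q. auto. }
      destruct Hn as [eps [He Hq]].
      exists (0%nat, mkposreal eps He). simpl. intros x y Hx Hy HS'.
      exfalso. apply (Hq _ HS'). unfold near; simpl.
      rewrite (Rabs_minus_sym u), (Rabs_minus_sym v). auto. }
  apply choice in Hg. destruct Hg as [nr Hnr].
  destruct (NNPP _ (compactness_list 2 (-M, (-M, tt)) (M, (M, tt)) (fun t => snd (nr t))))
    as [l Hl].
  exists (Datatypes.S (list_max (map (fun t => fst (nr t)) l))).
  intros [x y] Hp. destruct (HM _ Hp) as [Hx Hy]. simpl in Hx, Hy.
  apply Rabs_le_between in Hx. apply Rabs_le_between in Hy.
  destruct (Hl (x, (y, tt))) as [t [Hin [_ Ht]]]; [simpl; lra|].
  exists (fst (nr t)). split.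
  - apply Nat.lt_succ_r.
    assert (Hmax := list_max_le (map (fun t => fst (nr t)) l)
              (list_max (map (fun t => fst (nr t)) l))).
    destruct Hmax as [Hmax _]. specialize (Hmax (Nat.le_refl _)).
    rewrite Forall_forall in Hmax. apply Hmax.
    apply in_map_iff. exists t. auto.
  - destruct t as [t1 [t2 []]]. simpl in *. apply (Hnr (t1, (t2, tt))); simpl; tauto.
Qed.

(** Induction on the number of intervals: remove one that holds the right endpoint [y]; the others
    still cover everything up to just short of its left end. *)
Lemma finite_int_cover_length (l : list interval) (x y : R) :
  Forall proper_int l -> int_cover l (fun t => x <= t <= y) -> y - x <= sumR ilen l.
Proof.
  remember (length l) as n eqn:Hn. revert l Hn y.
  induction n as [|n IH]; intros l Hn y Hl Hc.
  - destruct l; [|discriminate]. simpl.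
    destruct (Rle_dec x y) as [H|H]; [|lra].
    destruct (Hc y) as [i [[] _]]; lra.
  - assert (Hpos : 0 <= sumR ilen l).
    { apply sumR_nonneg. rewrite Forall_forall in Hl. intros i Hi.
      specialize (Hl _ Hi). unfold proper_int, ilen in *. lra. }
    destruct (Rle_dec x y) as [H|H]; [|lra].
    destruct (Hc y) as [i [Hi Hy]]; [lra|].
    destruct (in_split _ _ Hi) as [l1 [l2 ->]].
    assert (Hl' : Forall proper_int (l1 ++ l2)).
    { rewrite Forall_app in *. destruct Hl as [? Hl]. inversion Hl. auto. }
    rewrite sumR_app in *. simpl in *. unfold in_int in Hy.
    assert (Hk : forall eta, 0 < eta -> fst i - eta - x <= sumR ilen (l1 ++ l2)).
    { intros eta He. apply IH; auto.
      - rewrite length_app in *. simpl in Hn. lia.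
      - intros t Ht. destruct (Hc t) as [j [Hj Htj]]; [lra|].
        exists j. split; [|exact Htj].
        apply in_app_iff. apply in_app_iff in Hj. destruct Hj as [|[->|]]; auto.
        unfold in_int in Htj. lra. }
    rewrite sumR_app in Hk. unfold ilen at 2.
    apply Rnot_lt_le. intros Hlt.
    (* Here [eta] is half the assumed deficit. *)
    specialize (Hk ((y - x - (sumR ilen l1 + (snd i - fst i + sumR ilen l2))) / 2)).
    lra.
Qed.

(** * Operations on countable covers and the outer measures they define *)

Lemma infinite_sum_cons (u : nat -> R) (x s : R) :
  infinite_sum u s ->
  infinite_sum (fun n => match n with O => x | S k => u k end) (x + s).
Proof.
  intros H eps He. destruct (H eps He) as [N HN].
  exists (S N). intros n Hn. destruct n as [|n]; [lia|].
  rewrite decomp_sum; [|lia]. simpl pred.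
  specialize (HN n ltac:(lia)). unfold Rdist in *.
  change (Rabs (x + sum_f_R0 u n - (x + s)) < eps).
  replace (x + sum_f_R0 u n - (x + s)) with (sum_f_R0 u n - s) by ring.
  exact HN.
Qed.

Lemma infinite_sum_zero : infinite_sum (fun _ => 0) 0.
Proof.
  intros eps He. exists 0%nat. intros n _. rewrite sum_eq_R0; auto.
  unfold Rdist. rewrite Rminus_0_r, Rabs_R0. exact He.
Qed.

Lemma infinite_sum_ext (u v : nat -> R) s :
  (forall n, u n = v n) -> infinite_sum u s -> infinite_sum v s.
Proof.
  intros E H eps He. destruct (H eps He) as [N HN]. exists N. intros n Hn.
  rewrite <- (sum_eq u v) by auto. auto.
Qed.

Lemma infinite_sum_nonneg_ge_partial (u : nat -> R) s N :
  infinite_sum u s -> (forall n, 0 <= u n) -> sum_f_R0 u N <= s.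
Proof. intros H Hu. now apply sum_incr. Qed.

Lemma cover_sums1_nonneg S s : cover_sums1 S s -> 0 <= s.
Proof.
  intros (a & b & Hab & _ & Hs).
  assert (H := infinite_sum_nonneg_ge_partial _ _ 0 Hs).
  simpl in H. assert (Hab0 := Hab 0%nat).
  enough (b 0%nat - a 0%nat <= s) by lra. apply H. intros n. specialize (Hab n). lra.
Qed.

Lemma cover_sums2_nonneg S s : cover_sums2 S s -> 0 <= s.
Proof.
  intros (a & b & c & d & Hab & _ & Hs).
  assert (Hn : forall n, 0 <= (b n - a n) * (d n - c n)).
  { intros n. specialize (Hab n). apply Rmult_le_pos; lra. }
  assert (H := infinite_sum_nonneg_ge_partial _ _ 0 Hs Hn). simpl in H.
  specialize (Hn 0%nat). lra.
Qed.

Lemma cover_sums1_subset (S T : R -> Prop) s :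
  (forall x, S x -> T x) -> cover_sums1 T s -> cover_sums1 S s.
Proof. intros H (a & b & ? & ? & ?). exists a, b. auto. Qed.

Lemma cover_sums2_subset (S T : pt -> Prop) s :
  (forall x, S x -> T x) -> cover_sums2 T s -> cover_sums2 S s.
Proof. intros H (a & b & c & d & ? & ? & ?). exists a, b, c, d. auto. Qed.

Lemma cover_sums1_cons (S : R -> Prop) (i : interval) s :
  proper_int i -> cover_sums1 S s ->
  cover_sums1 (fun x => in_int i x \/ S x) (ilen i + s).
Proof.
  intros Hi (a & b & Hab & Hc & Hs).
  exists (fun n => match n with O => fst i | S k => a k end),
         (fun n => match n with O => snd i | S k => b k end).
  split; [|split].
  - intros [|n]; auto.
  - intros x [Hx | Hx]; [now exists 0%nat|].
    destruct (Hc x Hx) as [n Hn]. now exists (Datatypes.S n).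
  - apply (infinite_sum_cons _ (ilen i)) in Hs.
    eapply infinite_sum_ext; [|exact Hs]. intros [|n]; reflexivity.
Qed.

Lemma cover_sums2_cons (S : pt -> Prop) (r : rect) s :
  proper_rect r -> cover_sums2 S s ->
  cover_sums2 (fun p => in_rect r p \/ S p) (area r + s).
Proof.
  intros [Hr1 Hr2] (a & b & c & d & Hab & Hc & Hs).
  exists (fun n => match n with O => fst (fst r) | S k => a k end),
         (fun n => match n with O => snd (fst r) | S k => b k end),
         (fun n => match n with O => fst (snd r) | S k => c k end),
         (fun n => match n with O => snd (snd r) | S k => d k end).
  split; [|split].
  - intros [|n]; auto.
  - intros p [Hp | Hp]; [now exists 0%nat|].
    destruct (Hc p Hp) as [n Hn]. now exists (Datatypes.S n).
  - apply (infinite_sum_cons _ (area r)) in Hs.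
    eapply infinite_sum_ext; [|exact Hs]. intros [|n]; reflexivity.
Qed.

Lemma cover_sums1_empty : cover_sums1 (fun _ => False) 0.
Proof.
  exists (fun _ => 0), (fun _ => 0). split; [intros; lra|]. split; [tauto|].
  eapply infinite_sum_ext; [|exact infinite_sum_zero]. intros; simpl; ring.
Qed.

Lemma cover_sums2_empty : cover_sums2 (fun _ => False) 0.
Proof.
  exists (fun _ => 0), (fun _ => 0), (fun _ => 0), (fun _ => 0).
  split; [intros; lra|]. split; [tauto|].
  eapply infinite_sum_ext; [|exact infinite_sum_zero]. intros; simpl; ring.
Qed.

Lemma cover_sums1_list (S : R -> Prop) (l : list interval) s :
  Forall proper_int l -> cover_sums1 S s ->
  cover_sums1 (fun x => (exists i, In i l /\ in_int i x) \/ S x) (sumR ilen l + s).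
Proof.
  intros Hl HS. induction l as [|i l IH]; simpl.
  - rewrite Rplus_0_l. revert HS. apply cover_sums1_subset. firstorder.
  - inversion Hl; subst. rewrite Rplus_assoc.
    eapply cover_sums1_subset; [|apply cover_sums1_cons; [assumption|apply IH; assumption]].
    intros x [[j [[<-|Hj] Hx]]|Hx]; eauto.
Qed.

Lemma cover_sums2_list (l : list rect) (S : pt -> Prop) :
  Forall proper_rect l -> rect_cover l S -> cover_sums2 S (sumR area l).
Proof.
  intros Hl Hc.
  apply (cover_sums2_subset _ (fun p => exists r, In r l /\ in_rect r p)); [exact Hc|].
  clear S Hc. induction l as [|r l IH]; simpl.
  - eapply cover_sums2_subset; [|exact cover_sums2_empty]. firstorder.
  - inversion Hl; subst.
    eapply cover_sums2_subset; [|apply cover_sums2_cons; [assumption|apply IH; assumption]].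
    intros x [j [[<-|Hj] Hx]]; eauto.
Qed.

Lemma is_inf_exists (P : R -> Prop) :
  (exists x, P x) -> (forall x, P x -> 0 <= x) -> exists v, is_inf P v.
Proof.
  intros [x0 H0] Hpos.
  destruct (completeness (fun y => P (- y))) as [m [Hm1 Hm2]].
  - exists 0. intros y Hy. specialize (Hpos _ Hy). lra.
  - exists (- x0). now rewrite Ropp_involutive.
  - exists (- m). split.
    + intros x Hx. assert (- x <= m) by (apply Hm1; now rewrite Ropp_involutive). lra.
    + intros w Hw. assert (m <= - w); [|lra]. apply Hm2. intros y Hy.
      specialize (Hw _ Hy). lra.
Qed.

Lemma is_inf_approx (P : R -> Prop) v eps :
  is_inf P v -> 0 < eps -> exists x, P x /\ x < v + eps.
Proof.
  intros [_ H2] He. apply NNPP. intros Hn.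
  assert (v + eps <= v); [|lra]. apply H2. intros x Hx.
  apply Rnot_lt_le. intros Hlt. apply Hn. eauto.
Qed.

Lemma leb1_of_cover S s : cover_sums1 S s -> exists r, leb1 S (Some r) /\ r <= s.
Proof.
  intros H. destruct (is_inf_exists (cover_sums1 S)) as [r Hr]; eauto using cover_sums1_nonneg.
  exists r. split; [exact Hr|]. now apply Hr.
Qed.

Lemma leb2_of_cover S s : cover_sums2 S s -> exists r, leb2 S (Some r) /\ r <= s.
Proof.
  intros H. destruct (is_inf_exists (cover_sums2 S)) as [r Hr]; eauto using cover_sums2_nonneg.
  exists r. split; [exact Hr|]. now apply Hr.
Qed.

Lemma leb1_nonneg S r : leb1 S (Some r) -> 0 <= r.
Proof. intros [_ H]. apply H. apply cover_sums1_nonneg. Qed.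

Lemma leb2_nonneg S r : leb2 S (Some r) -> 0 <= r.
Proof. intros [_ H]. apply H. apply cover_sums2_nonneg. Qed.

(** Finiteness is part of the conclusion: [Tstep] adds every point that has a line of infinite
    measure, so each comparison of lines must produce an actual value. *)
Lemma leb1_subset (S T : R -> Prop) r :
  (forall x, S x -> T x) -> leb1 T (Some r) -> exists r', leb1 S (Some r') /\ r' <= r.
Proof.
  intros H HT. destruct (is_inf_approx _ _ 1 HT) as [s [Hs _]]; [lra|].
  destruct (leb1_of_cover S s) as [r' [Hr' _]]; [eauto using cover_sums1_subset|].
  exists r'. split; [exact Hr'|]. apply HT. intros x Hx. apply Hr'.
  eauto using cover_sums1_subset.
Qed.

Lemma leb1_list_union (S T : R -> Prop) (l : list interval) r :
  Forall proper_int l -> leb1 S (Some r) ->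
  (forall x, T x -> (exists i, In i l /\ in_int i x) \/ S x) ->
  exists r', leb1 T (Some r') /\ r' <= sumR ilen l + r.
Proof.
  intros Hl HS HT.
  assert (Hc : forall s, cover_sums1 S s -> cover_sums1 T (sumR ilen l + s)).
  { intros s Hs. eapply cover_sums1_subset; [exact HT|]. now apply cover_sums1_list. }
  destruct (is_inf_approx _ _ 1 HS) as [s [Hs _]]; [lra|].
  destruct (leb1_of_cover T _ (Hc _ Hs)) as [r' [Hr' _]].
  exists r'. split; [exact Hr'|].
  assert (r' - sumR ilen l <= r); [|lra]. apply HS. intros x Hx.
  assert (r' <= sumR ilen l + x) by (apply Hr'; auto). lra.
Qed.

(** * From countable to finite covers with small excess *)

Fixpoint tabulate {T : Type} (u : nat -> T) (N : nat) : list T :=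
  match N with
  | O => []
  | S k => u k :: tabulate u k
  end.

Lemma in_tabulate {T} (u : nat -> T) N n : (n < N)%nat -> In (u n) (tabulate u N).
Proof.
  induction N as [|N IH]; intros H; [lia|]. simpl.
  destruct (Nat.eq_dec n N) as [->|]; [auto|]. right. apply IH. lia.
Qed.

Lemma Forall_tabulate {T} (P : T -> Prop) (u : nat -> T) N :
  (forall n, P (u n)) -> Forall P (tabulate u N).
Proof. intros H. induction N; simpl; constructor; auto. Qed.

(** The allowed excesses form a geometric series; the first N of them add up to eps (1 - 2^(-N)). *)
Lemma sumR_tabulate_le {T} (F : T -> R) (u : nat -> T) (v : nat -> R) s eps N :
  (forall n, F (u n) <= v n + eps * (/ 2) ^ S n) -> (forall n, 0 <= v n) ->
  infinite_sum v s -> 0 <= eps -> sumR F (tabulate u N) <= s + eps.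
Proof.
  intros Huv Hv Hs He.
  assert (H : forall N, sumR F (tabulate u N) <=
     match N with O => 0 | S k => sum_f_R0 v k end + eps * (1 - (/ 2) ^ N)).
  { intros m. induction m as [|m IH]; simpl; [lra|].
    specialize (Huv m). simpl in Huv.
    destruct m as [|m]; simpl in *; lra. }
  specialize (H N).
  assert (0 < (/ 2) ^ N) by (apply pow_lt; lra).
  assert (match N with O => 0 | S k => sum_f_R0 v k end <= s).
  { destruct N as [|k].
    - assert (Hp := infinite_sum_nonneg_ge_partial _ _ 0 Hs Hv). simpl in Hp.
      specialize (Hv 0%nat). lra.
    - now apply infinite_sum_nonneg_ge_partial. }
  nra.
Qed.

(** Room to enlarge a rectangle by [eta] on all four sides. The excess eta (2x + 2y + 4 eta) is at
    most eta (2x + 2y + 4) as soon as eta <= 1, which explains [k]. *)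
Lemma margin_exists (x y e : R) : 0 <= x -> 0 <= y -> 0 < e ->
  exists eta, 0 < eta /\ (x + 2 * eta) * (y + 2 * eta) <= x * y + e.
Proof.
  intros Hx Hy He.
  set (k := 2 * x + 2 * y + 4). assert (0 < k) by (unfold k; lra).
  exists (Rmin 1 (e / k)). assert (0 < e / k) by (apply Rdiv_lt_0_compat; lra).
  split; [apply Rmin_glb_lt; lra|].
  set (t := Rmin 1 (e / k)).
  assert (t <= 1) by apply Rmin_l. assert (t <= e / k) by apply Rmin_r.
  assert (0 < t) by (apply Rmin_glb_lt; lra).
  assert (t * k <= e).
  { apply (Rmult_le_compat_r k) in H2; [|lra].
    replace (e / k * k) with e in H2 by (field; lra). exact H2. }
  unfold k in *. nra.
Qed.

(** After a slight enlargement, the interiors of the rectangles of a near-optimal cover already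
    cover [S], so compactness selects finitely many. Half of [eps] pays for near-optimality, half
    for the enlargement. *)
Lemma finite_rect_cover (S : pt -> Prop) s eps :
  is_compact S -> leb2 S (Some s) -> 0 < eps ->
  exists l, Forall proper_rect l /\ rect_cover l S /\ sumR area l <= s + eps.
Proof.
  intros HS Hs He.
  destruct (is_inf_approx _ _ (eps / 2) Hs) as [s' [(a & b & c & d & Hab & Hc & Hsum) Hs']];
    [lra|].
  assert (Hm : forall n, exists eta, 0 < eta /\
     ((b n - a n) + 2 * eta) * ((d n - c n) + 2 * eta)
       <= (b n - a n) * (d n - c n) + (eps / 2) * (/ 2) ^ Datatypes.S n).
  { intros n. specialize (Hab n). apply margin_exists; try lra.
    apply Rmult_lt_0_compat; [lra|]. apply pow_lt. lra. }
  apply choice in Hm. destruct Hm as [eta Heta].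
  destruct (finite_subcover S (fun n => a n - eta n) (fun n => b n + eta n)
             (fun n => c n - eta n) (fun n => d n + eta n) HS) as [N HN].
  { intros p Hp. destruct (Hc p Hp) as [n Hn]. exists n. destruct (Heta n). lra. }
  set (u := fun n => ((a n - eta n, b n + eta n), (c n - eta n, d n + eta n)) : rect).
  exists (tabulate u N). split; [|split].
  - apply Forall_tabulate. intros n. destruct (Heta n). specialize (Hab n).
    unfold u, proper_rect, proper_int; simpl. lra.
  - intros p Hp. destruct (HN p Hp) as [n [Hn Hpn]].
    exists (u n). split; [now apply in_tabulate|].
    unfold u, in_rect, in_int; simpl. lra.
  - apply Rle_trans with (s' + eps / 2); [|lra].
    apply sumR_tabulate_le with (v := fun n => (b n - a n) * (d n - c n)); auto; try lra.
    + intros n. destruct (Heta n) as [_ H]. unfold u, area, ilen; simpl snd; simpl fst.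
      eapply Rle_trans; [|exact H]. right. ring.
    + intros n. specialize (Hab n). apply Rmult_le_pos; lra.
Qed.

(* Apply the planar compactness lemma to the degenerate set [0, L] x {0}. *)
Lemma leb1_interval_ge (S : R -> Prop) (L r : R) :
  (forall x, 0 <= x < L -> S x) -> leb1 S (Some r) -> L <= r.
Proof.
  intros HL HS.
  destruct (Rle_dec L 0) as [|HL0]; [apply leb1_nonneg in HS; lra|].
  apply Rnot_lt_le. intros Hlt.
  (* One [e] pays for near-optimality of the cover, one for enlarging its intervals, one for
     shortening [0, L) to the compact [0, L - e]; the fourth yields the contradiction. *)
  set (e := (L - r) / 4). assert (He : 0 < e) by (unfold e; lra).
  destruct (is_inf_approx _ _ e HS He) as [s [(a & b & Hab & Hc & Hs) Hs']].
  assert (Hp : forall n, 0 < e / 2 * (/ 2) ^ Datatypes.S n).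
  { intros n. apply Rmult_lt_0_compat; [lra|]. apply pow_lt. lra. }
  destruct (finite_subcover (fun p => 0 <= fst p <= L - e /\ snd p = 0)
    (fun n => a n - e / 2 * (/ 2) ^ Datatypes.S n)
    (fun n => b n + e / 2 * (/ 2) ^ Datatypes.S n) (fun _ => -1) (fun _ => 1)) as [N HN].
  - split.
    + intros [x y] H. simpl in *.
      assert (Hx : forall eps, 0 < eps -> - eps < x < L - e + eps /\ - eps < y < eps).
      { intros eps Heps. destruct (H eps Heps) as [[u v] [[Hu Hv] [H1 H2]]]. simpl in *.
        apply Rabs_def2 in H1. apply Rabs_def2 in H2. lra. }
      repeat split; apply NNPP; intros Hn.
      * specialize (Hx (- x)). lra.
      * specialize (Hx (x - (L - e))). lra.
      * destruct (Rtotal_order y 0) as [|[|]]; [specialize (Hx (-y)) | | specialize (Hx y)]; lra.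
    + exists L. intros [x y] [Hx Hy]. simpl in *. subst.
      rewrite Rabs_R0, Rabs_pos_eq; lra.
  - intros [x y] [Hx Hy]. simpl in *. subst.
    destruct (Hc x) as [n Hn]; [apply HL; lra|]. exists n. specialize (Hp n). lra.
  - set (u := fun n => (a n - e / 2 * (/ 2) ^ Datatypes.S n, b n + e / 2 * (/ 2) ^ Datatypes.S n) : interval).
    assert (H1 : L - e - 0 <= sumR ilen (tabulate u N)).
    { apply finite_int_cover_length.
      - apply Forall_tabulate. intros n. specialize (Hp n). specialize (Hab n).
        unfold proper_int, u; simpl in *; lra.
      - intros x Hx. destruct (HN (x, 0)) as [n [Hn Hxn]]; [simpl; lra|].
        exists (u n). split; [now apply in_tabulate|]. unfold u, in_int; simpl in *; lra. }
    assert (H2 : sumR ilen (tabulate u N) <= s + e).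
    { apply sumR_tabulate_le with (v := fun n => b n - a n); auto; try lra.
      - intros n. unfold ilen, u; simpl. lra.
      - intros n. specialize (Hab n). lra. }
    unfold e in *. lra.
Qed.

(** * Monotonicity and reflection symmetry of the growth process *)

Definition downset (Z : pt -> Prop) : Prop :=
  (forall p, Z p -> quadrant p) /\
  (forall a b u v, Z (a, b) -> 0 <= u <= a -> 0 <= v <= b -> Z (u, v)).

Definition empty_set : pt -> Prop := fun _ => False.

Lemma leb1_ext (S T : R -> Prop) r :
  (forall x, S x <-> T x) -> leb1 S (Some r) -> leb1 T (Some r).
Proof.
  intros H [H1 H2]. split.
  - intros x Hx. apply H1. revert Hx. apply cover_sums1_subset. firstorder.
  - intros w Hw. apply H2. intros x Hx. apply Hw. revert Hx.
    apply cover_sums1_subset. firstorder.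
Qed.

Lemma Titer_quadrant Z f g n A :
  (forall p, A p -> quadrant p) -> forall p, Titer Z f g n A p -> quadrant p.
Proof. intros HA. induction n as [|n IH]; simpl; auto. intros p [H | [H _]]; auto. Qed.

Lemma E_spans_intro Z f g A :
  (forall p, A p -> quadrant p) ->
  (forall p, quadrant p -> exists n, Titer Z f g n A p) -> E_spans Z f g A.
Proof. intros HA H p. split; [apply H|]. intros [n Hn]. eapply Titer_quadrant; eauto. Qed.

(** Line measures shrink with the set. Hence a pair in [Z] that withholds a point from [A'] yields a
    smaller pair for [A], which the downset [Z'] contains. *)
Lemma Tstep_mono Z Z' f g A A' :
  (forall p, Z p -> Z' p) -> downset Z' ->
  (forall x, 0 <= x -> 0 <= f x) -> (forall x, 0 <= x -> 0 <= g x) ->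
  (forall p, A p -> A' p) -> forall p, Tstep Z' f g A p -> Tstep Z f g A' p.
Proof.
  intros HZ [_ HZ'] Hf Hg HA p [Hp | [Hq Hp]]; [left; auto|].
  right. split; [exact Hq|]. intros (r & c & Hr & Hc & Hrc). apply Hp.
  destruct (leb1_subset (row_set p A) (row_set p A') r) as [r' [Hr' Hr'r]];
    [unfold row_set; auto | exact Hr|].
  destruct (leb1_subset (col_set p A) (col_set p A') c) as [c' [Hc' Hc'c]];
    [unfold col_set; auto | exact Hc|].
  exists r', c'. split; [exact Hr'|]. split; [exact Hc'|].
  destruct Hq as [Hq1 Hq2]. specialize (Hf _ Hq2). specialize (Hg _ Hq1).
  apply leb1_nonneg in Hr'. apply leb1_nonneg in Hc'.
  eapply HZ'; [apply HZ, Hrc | lra | lra].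
Qed.

Lemma E_spans_zero_mono Z Z' f g A :
  (forall p, Z p -> Z' p) -> downset Z' ->
  (forall x, 0 <= x -> 0 <= f x) -> (forall x, 0 <= x -> 0 <= g x) ->
  (forall p, A p -> quadrant p) -> E_spans Z' f g A -> E_spans Z f g A.
Proof.
  intros HZ HZ' Hf Hg HA H. apply E_spans_intro; [exact HA|]. intros p Hp.
  apply H in Hp. destruct Hp as [n Hn]. exists n. revert p Hn.
  induction n as [|n IH]; [auto|]. simpl. now apply Tstep_mono.
Qed.

Definition swap (p : pt) : pt := (snd p, fst p).
Definition swap_set (S : pt -> Prop) : pt -> Prop := fun p => S (swap p).

Lemma Titer_swap Z f g n A p :
  Titer (swap_set Z) g f n (swap_set A) p <-> Titer Z f g n A (swap p).
Proof.
  revert p. induction n as [|n IH]; intros p; [reflexivity|].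
  simpl. unfold Tstep. rewrite IH.
  assert (Hq : quadrant p <-> quadrant (swap p)) by (unfold quadrant, swap; simpl; tauto).
  rewrite Hq. apply or_iff_compat_l, and_iff_compat_l, not_iff_compat.
  assert (H1 : forall x, row_set p (Titer (swap_set Z) g f n (swap_set A)) x <->
                col_set (swap p) (Titer Z f g n A) x).
  { intros x. unfold row_set. rewrite IH. reflexivity. }
  assert (H2 : forall x, col_set p (Titer (swap_set Z) g f n (swap_set A)) x <->
                row_set (swap p) (Titer Z f g n A) x).
  { intros x. unfold col_set. rewrite IH. reflexivity. }
  split; intros (r & c & Hr & Hc & HZ); exists c, r; (split; [|split; [|exact HZ]]).
  - eapply leb1_ext; eauto.
  - eapply leb1_ext; eauto.
  - eapply leb1_ext; [|exact Hc]. intros x. symmetry. apply H1.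
  - eapply leb1_ext; [|exact Hr]. intros x. symmetry. apply H2.
Qed.

Lemma E_spans_swap Z f g A : E_spans (swap_set Z) f g (swap_set A) -> E_spans Z g f A.
Proof.
  intros H p. specialize (H (swap p)).
  assert (Hq : quadrant p <-> quadrant (swap p)) by (unfold quadrant, swap; simpl; tauto).
  rewrite Hq, H. destruct p as [u v].
  split; intros [n Hn]; exists n; revert Hn; rewrite Titer_swap; auto.
Qed.

Lemma cover_sums2_swap (S : pt -> Prop) s : cover_sums2 S s -> cover_sums2 (swap_set S) s.
Proof.
  intros (a & b & c & d & Hab & Hc & Hs). exists c, d, a, b. split; [|split].
  - intros n. destruct (Hab n). auto.
  - intros p Hp. destruct (Hc _ Hp) as [n [H1 H2]]. exists n. auto.
  - eapply infinite_sum_ext; [|exact Hs]. intros n; simpl; ring.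
Qed.

(** * The area bound: profiles of thickened zero-sets *)

Lemma profile_exists (Y : pt -> Prop) :
  is_closed Y -> is_bounded Y -> downset Y ->
  exists f, admissible f /\ (forall x v, Y (x, v) -> x <= f v) /\
    (forall x v, 0 <= x -> x < f v -> Y (x, v)).
Proof.
  intros Hcl [M HM] [Hq Hd].
  (* The extra element 0 keeps the set nonempty and gives the profile the value 0 at heights that
     [Y] does not meet. *)
  assert (Hsup : forall v, exists m, is_lub (fun x => x = 0 \/ Y (x, v)) m).
  { intros v. destruct (completeness (fun x => x = 0 \/ Y (x, v))) as [m Hm]; eauto.
    exists (Rmax 0 M). intros x [-> | Hx]; [apply Rmax_l|].
    apply HM in Hx. destruct Hx as [Hx _]. simpl in Hx.
    apply Rabs_le_between in Hx. eapply Rle_trans; [|apply Rmax_r]. lra. }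
  apply choice in Hsup. destruct Hsup as [f Hf].
  assert (Hge : forall x v, Y (x, v) -> x <= f v).
  { intros x v Hx. apply (Hf v). auto. }
  assert (Hlt : forall x v, 0 <= x -> x < f v -> Y (x, v)).
  { intros x v Hx Hxf. apply NNPP. intros Hn. assert (f v <= x); [|lra].
    apply (Hf v). intros y [-> | Hy]; [exact Hx|].
    apply Rnot_lt_le. intros Hxy. apply Hn.
    destruct (Hq _ Hy) as [_ Hv]. simpl in Hv.
    apply (Hd y v); auto; lra. }
  exists f. split; [|auto].
  assert (Hpos : forall v, 0 <= f v) by (intros v; apply (Hf v); auto).
  assert (Hmono : forall x y, 0 <= x <= y -> f y <= f x).
  { intros x y Hxy. apply (Hf y). intros z [-> | Hz]; [apply Hpos|].
    apply Hge. destruct (Hq _ Hz) as [Hz1 Hz2]. simpl in *. apply (Hd z y); auto; lra. }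
  repeat split; auto.
  - intros x Hx eps He. apply NNPP. intros Hn.
    (* If left continuity failed, [f] would be at least [f x + eps] at heights arbitrarily close
       below [x]; closedness of [Y] then carries the abscissa [f x + eps / 2] up to height [x]
       itself. *)
    assert (HY : Y (f x + eps / 2, x)).
    { apply Hcl. intros e' He'. apply NNPP. intros Hn'. apply Hn.
      exists (Rmin e' x). split; [apply Rmin_glb_lt; lra|].
      intros y Hy Hyx. specialize (Hmono y x ltac:(lra)). rewrite Rabs_pos_eq by lra.
      apply Rnot_le_lt. intros Hle. apply Hn'.
      exists (f x + eps / 2, y). split.
      - apply Hlt; [specialize (Hpos x)|]; lra.
      - unfold near; simpl. rewrite Rminus_diag, Rabs_R0. split; [exact He'|].
        assert (Rmin e' x <= e') by apply Rmin_l. rewrite Rabs_pos_eq; lra. }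
    apply Hge in HY. lra.
  - exists (M + 1). intros v Hv. apply Rle_antisym; [|apply Hpos].
    apply (Hf v). intros z [-> | Hz]; [lra|].
    apply HM in Hz. destruct Hz as [_ Hz]. simpl in Hz. apply Rabs_le_between in Hz. lra.
Qed.

(** For a downset [Z] and e >= 0 this is Z + [0, e]^2. Truncated subtraction presents it as a
    preimage under a continuous map, which makes closedness immediate. *)
Definition thicken (Z : pt -> Prop) (e : R) : pt -> Prop :=
  fun p => quadrant p /\ Z (Rmax (fst p - e) 0, Rmax (snd p - e) 0).

Lemma Rmax_minus_lipschitz x y e eps :
  Rabs (x - y) < eps -> Rabs (Rmax (x - e) 0 - Rmax (y - e) 0) < eps.
Proof.
  intros H. apply Rabs_def2 in H. apply Rabs_def1; unfold Rmax; repeat destruct Rle_dec; lra.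
Qed.

Lemma thicken_closed Z e : is_closed Z -> is_closed (thicken Z e).
Proof.
  intros Hcl p H. split.
  - split; apply Rnot_lt_le; intros Hn.
    + destruct (H (- fst p)) as [q [[[Hq _] _] [Hpq _]]]; [lra|]. apply Rabs_def2 in Hpq. lra.
    + destruct (H (- snd p)) as [q [[[_ Hq] _] [_ Hpq]]]; [lra|]. apply Rabs_def2 in Hpq. lra.
  - apply Hcl. intros eps He. destruct (H eps He) as [q [[_ Hq] [H1 H2]]].
    eexists. split; [exact Hq|]. split; simpl; now apply Rmax_minus_lipschitz.
Qed.

Lemma thicken_bounded Z e : is_bounded Z -> is_bounded (thicken Z e).
Proof.
  intros [M HM]. exists (M + Rabs e). intros p [[Hq1 Hq2] Hp]. apply HM in Hp. simpl in Hp.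
  destruct Hp as [H1 H2]. apply Rabs_le_between in H1. apply Rabs_le_between in H2.
  assert (Hx := Rmax_l (fst p - e) 0). assert (Hy := Rmax_l (snd p - e) 0).
  assert (e <= Rabs e) by apply Rle_abs.
  rewrite (Rabs_pos_eq (fst p)), (Rabs_pos_eq (snd p)) by assumption. lra.
Qed.

Lemma thicken_downset Z e : downset Z -> downset (thicken Z e).
Proof.
  intros [_ Hd]. split; [now intros p [Hp _]|].
  intros a b u v [_ Hab] Hu Hv. simpl in Hab. split; [split; simpl; lra|]. simpl.
  apply (Hd _ _ _ _ Hab); (split; [apply Rmax_r|]); apply Rle_max_compat_r; lra.
Qed.

(** Two strips of width [e] along the axes and a translate of [Z] by (e, e) suffice. The swap
    appears because a row profile is a function of the height, so its subgraph is the reflected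
    set. *)
Lemma cover_sums2_thicken_swap Z e M s :
  0 <= e -> 0 <= M -> (forall p, Z p -> fst p <= M /\ snd p <= M) -> cover_sums2 Z s ->
  cover_sums2 (swap_set (thicken Z e)) (s + 2 * e * (M + e)).
Proof.
  intros He HM Hb (a & b & c & d & Hab & Hc & Hs).
  set (r1 := ((0, e), (0, M + e)) : rect). set (r2 := ((0, M + e), (0, e)) : rect).
  replace (s + 2 * e * (M + e)) with (area r1 + (area r2 + s))
    by (unfold area, ilen; simpl; ring).
  set (S := fun p => e <= fst p /\ e <= snd p /\ Z (snd p - e, fst p - e)).
  apply (cover_sums2_subset _ (fun p => in_rect r1 p \/ in_rect r2 p \/ S p)).
  - intros [v x] [[Hx Hv] HZ]. simpl in *.
    assert (Hxy := Hb _ HZ). simpl in Hxy.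
    assert (H1 := Rmax_l (x - e) 0). assert (H2 := Rmax_l (v - e) 0).
    unfold in_rect, in_int, S; simpl.
    destruct (Rle_dec v e) as [|Hve]; [left; lra|].
    destruct (Rle_dec x e) as [|Hxe]; [right; left; lra|].
    right; right. rewrite !Rmax_left in HZ by lra. repeat split; auto; lra.
  - apply cover_sums2_cons; [unfold proper_rect, proper_int; simpl; lra|].
    apply cover_sums2_cons; [unfold proper_rect, proper_int; simpl; lra|].
    exists (fun n => c n + e), (fun n => d n + e), (fun n => a n + e), (fun n => b n + e).
    split; [intros n; destruct (Hab n); lra|]. split.
    + intros p (H1 & H2 & H3). destruct (Hc _ H3) as [n Hn]. exists n. simpl in Hn. lra.
    + eapply infinite_sum_ext; [|exact Hs]. intros n; simpl; ring.
Qed.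

(* The profile of the thickened zero-set exceeds the profile of [Z] at height [v - e] by [e];
   so once all rows below height [c] are full, all rows below [c + e] become full. *)
Lemma thick_profile_spans Z e f :
  downset Z -> 0 < e -> (forall x, 0 <= x -> 0 <= f x) ->
  (forall x v, thicken Z e (x, v) -> x <= f v) ->
  E_spans Z f (fun _ => 0) empty_set.
Proof.
  intros [_ Hd] He Hf Hge. apply E_spans_intro; [intros p []|].
  assert (H : forall n p, quadrant p -> snd p < INR n * e ->
            Titer Z f (fun _ => 0) n empty_set p).
  { intros n. induction n as [|n IH]; intros [u v] [Hu Hv] Hn; cbn [fst snd] in *;
      [simpl in Hn; lra|].
    rewrite S_INR in Hn.
    right. split; [split; simpl; auto|]. intros (r & c & Hr & Hc & HZ). simpl in HZ.
    assert (Hc' : INR n * e <= c).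
    { apply (leb1_interval_ge _ _ _ ) with (2 := Hc). intros x Hx.
      unfold col_set. apply IH; [split; simpl; lra|]. simpl. lra. }
    apply leb1_nonneg in Hr.
    (* A withholding pair would put (f(v), max(v - e, 0)) into [Z], since c >= n e > v - e. Then
       (f(v) + e, v) would be a point of the thickened set beyond its profile. *)
    assert (Hle : f v + e <= f v); [|lra].
    apply Hge. specialize (Hf v Hv). split; [split; simpl; lra|]. simpl.
    rewrite Rmax_left by lra.
    apply (Hd _ _ _ _ HZ); [lra|]. split; [apply Rmax_r|].
    assert (0 <= INR n * e) by (apply Rmult_le_pos; [apply pos_INR | lra]).
    apply Rmax_lub; lra. }
  intros p Hp. destruct (nfloor_ex (snd p / e)) as [n Hn].
  { apply Rdiv_le_0_compat; [apply Hp | exact He]. }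
  exists (S n). apply H; [exact Hp|]. rewrite S_INR.
  apply (Rmult_lt_reg_r (/ e)); [now apply Rinv_0_lt_compat|].
  replace ((INR n + 1) * e * / e) with (INR n + 1) by (field; lra).
  apply Hn.
Qed.

Lemma admissible_zero : admissible (fun _ => 0).
Proof.
  repeat split; intros; try lra; [|now exists 0].
  exists 1. split; [lra|]. intros. rewrite Rminus_diag, Rabs_R0. assumption.
Qed.

Lemma leb2_null (S : pt -> Prop) : (forall p, ~ S p) -> leb2 S (Some 0).
Proof.
  intros H. destruct (leb2_of_cover S 0) as [r [Hr Hr0]].
  { eapply cover_sums2_subset; [|exact cover_sums2_empty]. exact H. }
  assert (r = 0) as -> by (apply leb2_nonneg in Hr; lra). exact Hr.
Qed.

Lemma leb2_subgraph_zero : leb2 (subgraph (fun _ => 0)) (Some 0).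
Proof. apply leb2_null. unfold subgraph. intros p (_ & ? & ?). lra. Qed.

Lemma empty_compact : is_compact empty_set.
Proof.
  split; [|exists 0; intros p []]. intros p H. destruct (H 1) as [q [[] _]]. lra.
Qed.

Lemma row_strip_exists Z s eps :
  is_compact Z -> downset Z -> cover_sums2 Z s -> 0 < eps ->
  exists f iF, admissible f /\ E_spans Z f (fun _ => 0) empty_set /\
    leb2 (subgraph f) (Some iF) /\ iF <= s + eps.
Proof.
  intros [Hcl [M HM]] Hd Hs Heps.
  set (M' := Rmax M 0). assert (HM'0 : 0 <= M') by apply Rmax_r.
  assert (HM' : forall p, Z p -> fst p <= M' /\ snd p <= M').
  { intros p Hp. destruct (HM p Hp) as [H1 H2]. assert (M <= M') by apply Rmax_l.
    apply Rabs_le_between in H1. apply Rabs_le_between in H2. lra. }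
  (* With second side 0 this bounds 2e (M' + 2e) by [eps], enough for the cost 2e (M' + e) of the
     two strips. *)
  destruct (margin_exists M' 0 eps) as [e [He Hle]]; try lra.
  destruct (profile_exists (thicken Z e)) as (f & Hf & Hge & Hlt).
  { now apply thicken_closed. }
  { apply thicken_bounded. now exists M. }
  { now apply thicken_downset. }
  destruct (leb2_of_cover (subgraph f) (s + 2 * e * (M' + e))) as [iF [HiF HiF']].
  { eapply cover_sums2_subset; [|eapply cover_sums2_thicken_swap; try eassumption; lra].
    intros [v x] (Hv & Hx & Hvx). simpl in *. unfold swap_set, swap; simpl. now apply Hlt. }
  exists f, iF. split; [exact Hf|]. split; [|split; [exact HiF|nra]].
  apply (thick_profile_spans Z e f); auto.
  apply Hf.
Qed.

(** * Step functions, their distributions and their discretization *)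

Definition upclosed (U : R -> Prop) : Prop := forall x y, 0 <= x <= y -> U x -> U y.

Definition dominates (f phi : R -> R) : Prop :=
  forall U, upclosed U -> forall r, leb1 (fun v => 0 <= v /\ U (f v)) (Some r) ->
  exists r', leb1 (fun v => 0 <= v /\ U (phi v)) (Some r') /\ r' <= r.

Definition bump (t : R * interval) (v : R) : R :=
  if Rle_dec (fst (snd t)) v then if Rle_dec v (snd (snd t)) then fst t else 0 else 0.
Definition simple (l : list (R * interval)) (v : R) : R := sumR (fun t => bump t v) l.
Definition mass (l : list (R * interval)) : R := sumR (fun t => fst t * ilen (snd t)) l.
Definition proper_bump (t : R * interval) : Prop := 0 <= fst t /\ proper_int (snd t).

Lemma bump_nonneg t v : proper_bump t -> 0 <= bump t v.
Proof. intros [H _]. unfold bump. repeat destruct Rle_dec; lra. Qed.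

Lemma simple_nonneg l v : Forall proper_bump l -> 0 <= simple l v.
Proof.
  intros H. apply sumR_nonneg. intros t Ht. apply bump_nonneg.
  rewrite Forall_forall in H. auto.
Qed.

Lemma simple_support l : exists M, forall v, M <= v -> simple l v = 0.
Proof.
  induction l as [|t l [M HM]]; [exists 0; reflexivity|].
  exists (Rmax M (snd (snd t) + 1)). intros v Hv. unfold simple in *; simpl.
  assert (H1 := Rmax_l M (snd (snd t) + 1)). assert (H2 := Rmax_r M (snd (snd t) + 1)).
  rewrite HM by lra. unfold bump. repeat destruct Rle_dec; lra.
Qed.

Fixpoint nsum (u : nat -> nat) (N : nat) : nat :=
  match N with
  | O => O
  | S k => (u k + nsum u k)%nat
  end.

Lemma nsum_add u v N : nsum (fun j => (u j + v j)%nat) N = (nsum u N + nsum v N)%nat.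
Proof. induction N; simpl; lia. Qed.

Lemma nsum_ext u v N : (forall j, u j = v j) -> nsum u N = nsum v N.
Proof. intros H. induction N; simpl; auto. Qed.

Lemma nsum_ge_term u N j : (j < N)%nat -> (u j <= nsum u N)%nat.
Proof.
  induction N as [|N IH]; intros H; [lia|]. simpl.
  destruct (Nat.eq_dec j N) as [->|]; [|specialize (IH ltac:(lia))]; lia.
Qed.

(** The i-th part of the partition conjugate to [u] on the indices below [N]. *)
Definition level (u : nat -> nat) (N i : nat) : nat :=
  nsum (fun j => if Nat.ltb i (u j) then 1 else 0)%nat N.

Lemma level_antitone u N i i' : (i <= i')%nat -> (level u N i' <= level u N i)%nat.
Proof.
  intros H. unfold level. induction N as [|N IH]; simpl; [lia|].
  destruct (Nat.ltb_spec i' (u N)); destruct (Nat.ltb_spec i (u N)); lia.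
Qed.

(** Both sides count the cells (i, j) with j < N and i < u j; the bound [K] ensures that no cell is
    left out. *)
Lemma nsum_level u N K : (forall j, (j < N)%nat -> (u j <= K)%nat) ->
  nsum (level u N) K = nsum u N.
Proof.
  assert (Hind : forall m k, nsum (fun i => if Nat.ltb i m then 1 else 0)%nat k = Nat.min k m).
  { intros m k. induction k as [|k IH]; [reflexivity|]. cbn [nsum]. rewrite IH.
    destruct (Nat.ltb_spec k m); lia. }
  induction N as [|N IH]; intros H.
  - simpl. clear. induction K; simpl; auto.
  - simpl. rewrite <- IH by auto.
    rewrite (nsum_ext (level u (S N))
      (fun i => ((if Nat.ltb i (u N) then 1 else 0) + level u N i)%nat)) by reflexivity.
    rewrite nsum_add, Hind. specialize (H N ltac:(lia)). lia.
Qed.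

Lemma nsum_window W A B N :
  (nsum (fun j => if andb (Nat.leb A j) (Nat.ltb j B) then W else 0) N <= W * (B - A))%nat.
Proof.
  assert (H : (nsum (fun j => if andb (Nat.leb A j) (Nat.ltb j B) then W else 0) N
               <= W * (Nat.min N B - A))%nat).
  { induction N as [|N IH]; [simpl; lia|]. cbn [nsum].
    assert (Hm : (Nat.min N B - A <= Nat.min (S N) B - A)%nat) by lia.
    apply (Nat.mul_le_mono_l _ _ W) in Hm.
    destruct (Nat.leb_spec A N); destruct (Nat.ltb_spec N B); cbn [andb]; try lia.
    replace (Nat.min (S N) B - A)%nat with (S (Nat.min N B - A)) by lia. lia. }
  eapply Nat.le_trans; [exact H|]. apply Nat.mul_le_mono_l. lia.
Qed.

Lemma grid_floor delta x : 0 < delta -> 0 <= x ->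
  exists k, delta * INR k <= x < delta * (INR k + 1).
Proof.
  intros Hd Hx. destruct (nfloor_ex (x / delta)) as [k [H1 H2]].
  { now apply Rdiv_le_0_compat. }
  exists k.
  replace x with (delta * (x / delta)) by (field; lra).
  split; [apply Rmult_le_compat_l | apply Rmult_lt_compat_l]; lra.
Qed.

Lemma grid_lt delta i j : 0 < delta -> delta * INR i < delta * (INR j + 1) -> (i <= j)%nat.
Proof.
  intros Hd H. apply Rmult_lt_reg_l in H; [|exact Hd].
  rewrite <- S_INR in H. apply INR_lt in H. lia.
Qed.

(** The weight is rounded up and the interval enlarged to whole cells of a grid of mesh [delta]. The
    error term comes from (w + delta)(b - a + 2 delta) <= w (b - a) + delta (2w + (b - a) + 2),
    valid for delta <= 1. *)
Lemma bump_discretize (t : R * interval) delta :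
  proper_bump t -> 0 < delta <= 1 ->
  exists (u : nat -> nat) (N : nat),
    (forall j, (N <= j)%nat -> u j = O) /\
    (forall N', delta * delta * INR (nsum u N') <=
       fst t * ilen (snd t) + delta * (2 * fst t + ilen (snd t) + 2)) /\
    (forall v j, 0 <= v -> delta * INR j <= v < delta * (INR j + 1) ->
       bump t v <= delta * INR (u j)).
Proof.
  destruct t as [w [a b]]. unfold proper_bump, proper_int, ilen; simpl.
  intros [Hw Hab] Hd.
  destruct (Rlt_dec b 0) as [Hb|Hb].
  { exists (fun _ => O), O. split; [auto|]. split.
    - intros N'. replace (nsum (fun _ => O) N') with O by (induction N'; simpl; auto).
      simpl. rewrite Rmult_0_r.
      assert (0 <= w * (b - a)) by (apply Rmult_le_pos; lra).
      assert (0 <= delta * (2 * w + (b - a) + 2)) by (apply Rmult_le_pos; lra). lra.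
    - intros v j Hv _. unfold bump; simpl. repeat destruct Rle_dec; lra. }
  destruct (grid_floor delta w) as [W HW]; [lra | lra |].
  destruct (grid_floor delta (Rmax a 0)) as [A HA]; [lra | apply Rmax_r |].
  destruct (grid_floor delta b) as [B HB]; [lra | lra |].
  assert (Ha := Rmax_l a 0).
  exists (fun j => if andb (Nat.leb A j) (Nat.ltb j (S B)) then S W else O), (S B).
  split; [|split].
  - intros j Hj. destruct (Nat.ltb_spec j (S B)); [lia|]. now rewrite Bool.andb_false_r.
  - intros N'.
    assert (H := nsum_window (S W) A (S B) N'). apply le_INR in H. rewrite mult_INR in H.
    assert (H1 : 0 <= delta * INR (S W) <= w + delta).
    { split; [apply Rmult_le_pos; [lra | apply pos_INR]|]. rewrite S_INR. lra. }
    assert (H2 : 0 <= delta * INR (S B - A) <= b - a + 2 * delta).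
    { split; [apply Rmult_le_pos; [lra | apply pos_INR]|].
      destruct (Nat.le_gt_cases A (S B)) as [Hle|Hgt].
      - rewrite minus_INR, S_INR by exact Hle. lra.
      - replace (S B - A)%nat with O by lia. simpl. lra. }
    assert (H3 : (delta * INR (S W)) * (delta * INR (S B - A)) <= (w + delta) * (b - a + 2 * delta)).
    { apply Rmult_le_compat; lra. }
    set (m := nsum _ N') in *.
    assert (H4 : delta * delta * INR m <= (delta * INR (S W)) * (delta * INR (S B - A))).
    { replace ((delta * INR (S W)) * (delta * INR (S B - A))) with
        (delta * delta * (INR (S W) * INR (S B - A))) by ring.
      apply Rmult_le_compat_l; [nra | exact H]. }
    nra.
  - intros v j Hv Hj. unfold bump; simpl fst; simpl snd.
    assert (Hge : forall k, 0 <= delta * INR k).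
    { intros k. apply Rmult_le_pos; [lra | apply pos_INR]. }
    destruct (Rle_dec a v) as [Hav|]; [|apply Hge].
    destruct (Rle_dec v b) as [Hvb|]; [|apply Hge].
    assert (A <= j)%nat.
    { apply (grid_lt delta); [lra|]. assert (Rmax a 0 <= v) by now apply Rmax_lub. lra. }
    assert (j <= B)%nat by (apply (grid_lt delta); lra).
    destruct (Nat.leb_spec A j); [|lia]. destruct (Nat.ltb_spec j (S B)); [|lia].
    cbn [andb]. rewrite S_INR. lra.
Qed.

(** The constant [C] is fixed before [delta], so the excess [delta * C] can be made arbitrarily
    small. *)
Lemma simple_discretize l : Forall proper_bump l ->
  exists C, 0 <= C /\ forall delta, 0 < delta <= 1 ->
  exists (u : nat -> nat) (N : nat),
    (forall j, (N <= j)%nat -> u j = O) /\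
    (forall N', delta * delta * INR (nsum u N') <= mass l + delta * C) /\
    (forall v j, 0 <= v -> delta * INR j <= v < delta * (INR j + 1) ->
       simple l v <= delta * INR (u j)).
Proof.
  induction l as [|t l IH]; intros Hl.
  - exists 0. split; [lra|]. intros delta Hd. exists (fun _ => O), O.
    split; [auto|]. split.
    + intros N'. replace (nsum (fun _ => O) N') with O by (induction N'; simpl; auto).
      unfold mass; simpl. lra.
    + intros. unfold simple; simpl. lra.
  - inversion Hl as [|? ? Ht Hl']; subst. destruct (IH Hl') as [C [HC H]].
    exists (C + (2 * fst t + ilen (snd t) + 2)). split.
    { destruct Ht as [H1 H2]. unfold proper_int, ilen in *. lra. }
    intros delta Hd. destruct (H delta Hd) as (u & N & Hu0 & Hum & Hu).
    destruct (bump_discretize t delta Ht Hd) as (u' & N' & Hu0' & Hum' & Hu').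
    exists (fun j => (u' j + u j)%nat), (Nat.max N N'). split; [|split].
    + intros j Hj. rewrite Hu0, Hu0' by lia. reflexivity.
    + intros K. rewrite nsum_add, plus_INR. specialize (Hum K). specialize (Hum' K).
      unfold mass in *; simpl. lra.
    + intros v j Hv Hj. specialize (Hu v j Hv Hj). specialize (Hu' v j Hv Hj).
      rewrite plus_INR. unfold simple in *; simpl. lra.
Qed.

(** * Staircases and the decreasing rearrangement *)

Lemma admissible_plus f g : admissible f -> admissible g -> admissible (fun x => f x + g x).
Proof.
  intros (Hf1 & Hf2 & Hf3 & [Mf Hf4]) (Hg1 & Hg2 & Hg3 & [Mg Hg4]).
  split; [|split; [|split]].
  - intros x Hx. specialize (Hf1 x Hx). specialize (Hg1 x Hx). lra.
  - intros x y Hxy. specialize (Hf2 x y Hxy). specialize (Hg2 x y Hxy). lra.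
  - intros x Hx eps He.
    destruct (Hf3 x Hx (eps / 2)) as [d1 [Hd1 H1]]; [lra|].
    destruct (Hg3 x Hx (eps / 2)) as [d2 [Hd2 H2]]; [lra|].
    exists (Rmin d1 d2). split; [now apply Rmin_glb_lt|]. intros y Hy Hyx.
    assert (Rmin d1 d2 <= d1) by apply Rmin_l. assert (Rmin d1 d2 <= d2) by apply Rmin_r.
    specialize (H1 y Hy ltac:(lra)). specialize (H2 y Hy ltac:(lra)).
    apply Rabs_def2 in H1. apply Rabs_def2 in H2. apply Rabs_def1; lra.
  - exists (Rmax Mf Mg). intros x Hx.
    assert (Mf <= Rmax Mf Mg) by apply Rmax_l. assert (Mg <= Rmax Mf Mg) by apply Rmax_r.
    rewrite Hf4, Hg4 by lra. lra.
Qed.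

Lemma admissible_step delta L : 0 <= delta ->
  admissible (fun v => if Rle_dec v L then delta else 0).
Proof.
  intros Hd. split; [|split; [|split]].
  - intros x _. destruct Rle_dec; lra.
  - intros x y Hxy. repeat destruct Rle_dec; lra.
  - intros x Hx eps He. destruct (Rle_dec x L) as [HxL|HxL].
    + exists 1. split; [lra|]. intros y _ Hy. destruct (Rle_dec y L); [|lra].
      rewrite Rminus_diag, Rabs_R0. exact He.
    + exists (x - L). split; [lra|]. intros y _ Hy. destruct (Rle_dec y L); [lra|].
      rewrite Rminus_diag, Rabs_R0. exact He.
  - exists (L + 1). intros x Hx. destruct Rle_dec; lra.
Qed.

(** A sum of layers, so that admissibility is inherited term by term; the closed right ends give
    left continuity. For antitone [c] the layers are nested and form a staircase. *)
Fixpoint stair (delta : R) (c : nat -> nat) (K : nat) (v : R) : R :=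
  match K with
  | O => 0
  | S k => stair delta c k v + (if Rle_dec v (delta * INR (c k)) then delta else 0)
  end.

Lemma admissible_stair delta c K : 0 <= delta -> admissible (stair delta c K).
Proof.
  intros Hd. induction K as [|K IH]; [apply admissible_zero|].
  apply (admissible_plus (stair delta c K)); [exact IH | now apply admissible_step].
Qed.

Lemma stair_full delta c K v :
  (forall i, (i < K)%nat -> v <= delta * INR (c i)) -> stair delta c K v = delta * INR K.
Proof.
  intros H. induction K as [|K IH]; [simpl; ring|].
  rewrite S_INR. simpl stair. rewrite IH by auto. specialize (H K ltac:(lia)).
  destruct Rle_dec; lra.
Qed.

Lemma stair_initial delta (c : nat -> nat) i i' v :
  0 < delta -> (forall i i', (i <= i')%nat -> (c i' <= c i)%nat) ->
  (i <= i')%nat -> v <= delta * INR (c i') -> v <= delta * INR (c i).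
Proof.
  intros Hd Hc Hi Hv. eapply Rle_trans; [exact Hv|]. apply Rmult_le_compat_l; [lra|].
  apply le_INR. now apply Hc.
Qed.

Lemma stair_ge delta (c : nat -> nat) K i v :
  0 < delta -> (forall i i', (i <= i')%nat -> (c i' <= c i)%nat) ->
  (i < K)%nat -> v <= delta * INR (c i) -> delta * (INR i + 1) <= stair delta c K v.
Proof.
  intros Hd Hc Hi Hv. induction K as [|K IH]; [lia|].
  destruct (Nat.eq_dec i K) as [->|Hne].
  - rewrite <- S_INR, stair_full; [lra|]. intros j Hj. apply stair_initial with K; auto; lia.
  - simpl. specialize (IH ltac:(lia)). destruct Rle_dec; lra.
Qed.

Definition stair_rects (delta : R) (c : nat -> nat) (K : nat) : list rect :=
  tabulate (fun i => ((0, delta * INR (c i)), (delta * INR i, delta * (INR i + 1)))) K.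

Lemma stair_rects_proper delta c K :
  0 <= delta -> Forall proper_rect (stair_rects delta c K).
Proof.
  intros Hd.   apply Forall_tabulate. intros i. unfold proper_rect, proper_int; simpl.
  split; [apply Rmult_le_pos; [lra | apply pos_INR] | lra].
Qed.

Lemma stair_rects_area delta c K :
  sumR area (stair_rects delta c K) = delta * delta * INR (nsum c K).
Proof.
  unfold stair_rects. induction K as [|K IH]; simpl; [ring|].
  rewrite IH, plus_INR. unfold area, ilen; simpl. ring.
Qed.

Lemma stair_rects_cover delta (c : nat -> nat) K :
  0 < delta -> (forall i i', (i <= i')%nat -> (c i' <= c i)%nat) ->
  rect_cover (stair_rects delta c K) (subgraph (stair delta c K)).
Proof.
  intros Hd Hc [v y] (Hv & Hy & Hvy). cbn [fst snd] in *.
  induction K as [|K IH]; [simpl in Hvy; lra|].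
  destruct (Rlt_dec y (stair delta c K v)) as [Hlt|Hge].
  - destruct (IH Hlt) as [r [Hr Hin]]. exists r. split; [right; exact Hr | exact Hin].
  - simpl in Hvy. destruct (Rle_dec v (delta * INR (c K))) as [HvK|]; [|lra].
    rewrite stair_full in * by (intros j Hj; apply stair_initial with K; auto; lia).
    eexists. split; [left; reflexivity|]. unfold in_rect, in_int; simpl. lra.
Qed.

Fixpoint level_cells (delta : R) (u : nat -> nat) (N i : nat) : list interval :=
  match N with
  | O => []
  | S k => (if Nat.ltb i (u k) then [(delta * INR k, delta * (INR k + 1))] else [])
           ++ level_cells delta u k i
  end.

Lemma level_cells_length delta u N i :
  sumR ilen (level_cells delta u N i) = delta * INR (level u N i).
Proof.
  unfold level. induction N as [|N IH]; simpl; [ring|].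
  rewrite sumR_app, IH, plus_INR. destruct (Nat.ltb i (u N)); unfold ilen; simpl; ring.
Qed.

Lemma level_cells_proper delta u N i :
  0 <= delta -> Forall proper_int (level_cells delta u N i).
Proof.
  intros Hd. induction N as [|N IH]; simpl; [constructor|].
  apply Forall_app. split; [|exact IH].
  destruct (Nat.ltb i (u N)); constructor; [|constructor]. unfold proper_int; simpl. lra.
Qed.

Lemma in_level_cells delta u N i j : (j < N)%nat -> (i < u j)%nat ->
  In (delta * INR j, delta * (INR j + 1)) (level_cells delta u N i).
Proof.
  intros Hj Hi. induction N as [|N IH]; [lia|]. simpl. apply in_app_iff.
  destruct (Nat.eq_dec j N) as [->|]; [|right; apply IH; lia].
  left. destruct (Nat.ltb_spec i (u N)); [left; reflexivity | lia].
Qed.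

Lemma least_nat (P : nat -> Prop) :
  (exists n, P n) -> exists n, P n /\ forall m, P m -> (n <= m)%nat.
Proof.
  intros H. destruct (Wf_nat.dec_inh_nat_subset_has_unique_least_element P) as [n [Hn _]].
  - intros n. apply classic.
  - exact H.
  - eauto.
Qed.

(* Conjugating the discretized function [delta * u] twice sorts it: the rearrangement is the
   staircase whose [i]-th layer has the length of the superlevel set [u > i]. *)
Lemma rearrangement_exists l eps : Forall proper_bump l -> 0 < eps ->
  exists f iF, admissible f /\ leb2 (subgraph f) (Some iF) /\ iF <= mass l + eps /\
    dominates f (simple l).
Proof.
  intros Hl Heps. destruct (simple_discretize l Hl) as [C [HC Hdisc]].
  set (delta := Rmin 1 (eps / (C + 1))).
  assert (He' : 0 < eps / (C + 1)) by (apply Rdiv_lt_0_compat; lra).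
  assert (Hd0 : 0 < delta) by (apply Rmin_glb_lt; lra).
  assert (Hd1 : delta <= 1) by apply Rmin_l.
  assert (HdC : delta * C <= eps).
  { assert (Hd2 : delta <= eps / (C + 1)) by apply Rmin_r.
    apply (Rmult_le_compat_r (C + 1)) in Hd2; [|lra].
    replace (eps / (C + 1) * (C + 1)) with eps in Hd2 by (field; lra). nra. }
  destruct (Hdisc delta) as (u & N & Hu0 & Hum & Hu); [lra|].
  (* The total serves as a crude common bound for all heights [u j]. *)
  set (K := nsum u N). set (c := level u N).
  assert (Hc : forall i i', (i <= i')%nat -> (c i' <= c i)%nat) by (intros; now apply level_antitone).
  assert (HK : forall j, (u j <= K)%nat).
  { intros j. destruct (Nat.lt_ge_cases j N); [now apply nsum_ge_term|]. rewrite Hu0; lia. }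
  destruct (leb2_of_cover (subgraph (stair delta c K)) (delta * delta * INR (nsum c K)))
    as [iF [HiF HiF']].
  { rewrite <- stair_rects_area. apply cover_sums2_list.
    - apply stair_rects_proper. lra.
    - now apply stair_rects_cover. }
  exists (stair delta c K), iF. split; [apply admissible_stair; lra|]. split; [exact HiF|].
  split.
  { unfold c in HiF'. rewrite nsum_level in HiF' by auto. specialize (Hum N). lra. }
  intros U HU r Hr.
  (* If 0 belongs to [U], so does every value of the staircase. Otherwise cells with u = 0 cannot
     contribute, which confines the set for [simple l] to finitely many cells. *)
  destruct (classic (U 0)) as [HU0|HU0].
  { eapply leb1_subset; [|exact Hr]. intros v [Hv _]. split; [exact Hv|].
    apply HU with 0; [|exact HU0]. split; [lra|].
    apply (admissible_stair delta c K); lra. }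
  assert (Hcell : forall v, 0 <= v -> U (simple l v) -> exists j i,
     (j < N)%nat /\ (i < K)%nat /\ u j = S i /\ U (delta * (INR i + 1)) /\
     delta * INR j <= v < delta * (INR j + 1)).
  { intros v Hv HUv. destruct (grid_floor delta v Hd0 Hv) as [j Hj].
    assert (HUj : U (delta * INR (u j))).
    { apply HU with (simple l v); [|exact HUv].
      split; [now apply simple_nonneg | now apply Hu]. }
    assert (HKj := HK j).
    destruct (u j) as [|i] eqn:Ej; [simpl in HUj; rewrite Rmult_0_r in HUj; contradiction|].
    exists j, i. rewrite S_INR in HUj. repeat split; auto; try lra.
    destruct (Nat.lt_ge_cases j N) as [|Hge]; [assumption|]. rewrite Hu0 in Ej; [discriminate | lia]. }
  destruct (classic (exists i, (i < K)%nat /\ U (delta * (INR i + 1)))) as [Hex|Hno].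
  (* Only the least grid value delta (i0 + 1) in [U] matters: the staircase is at least that high on
     [0, delta c(i0)), while the set for [simple l] lies in the c(i0) cells with u > i0, which have
     the same total length. *)
  - apply least_nat in Hex. destruct Hex as [i0 [[Hi0 HUi0] Hmin]].
    assert (Hrc : delta * INR (c i0) <= r).
    { apply leb1_interval_ge with (2 := Hr). intros v Hv. split; [lra|].
      apply HU with (delta * (INR i0 + 1)); [|exact HUi0].
      split; [apply Rmult_le_pos; [lra|]; assert (H := pos_INR i0); lra|].
      apply stair_ge; auto. lra. }
    destruct (leb1_of_cover (fun v => 0 <= v /\ U (simple l v)) (delta * INR (c i0)))
      as [r' [Hr' Hr'c]].
    { unfold c. rewrite <- level_cells_length, <- (Rplus_0_r (sumR _ _)).
      eapply cover_sums1_subset;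
        [|apply cover_sums1_list; [apply level_cells_proper; lra | exact cover_sums1_empty]].
      intros v [Hv HUv]. left.
      destruct (Hcell v Hv HUv) as (j & i & Hj & Hi & Ej & HUi & Hvj).
      exists (delta * INR j, delta * (INR j + 1)). split; [|unfold in_int; simpl; lra].
      apply in_level_cells; [exact Hj|]. specialize (Hmin i (conj Hi HUi)). lia. }
    exists r'. split; [exact Hr' | lra].
  - eapply leb1_subset; [|exact Hr]. intros v [Hv HUv]. exfalso.
    destruct (Hcell v Hv HUv) as (j & i & Hj & Hi & Ej & HUi & Hvj). apply Hno. eauto.
Qed.

(* The growth process seen through the values [x = phi v], [y = psi u]: it only depends on
   the distributions of [phi] and [psi], hence is monotone under [dominates]. *)
Fixpoint value_process (Z : pt -> Prop) (phi psi : R -> R) (n : nat) (x y : R) : Prop :=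
  match n with
  | O => False
  | S k => value_process Z phi psi k x y \/
      ~ (exists r c,
           leb1 (fun u => 0 <= u /\ value_process Z phi psi k x (psi u)) (Some r) /\
           leb1 (fun v => 0 <= v /\ value_process Z phi psi k (phi v) y) (Some c) /\
           Z (r + x, c + y))
  end.

Lemma value_process_upclosed Z phi psi n :
  downset Z -> (forall v, 0 <= phi v) -> (forall u, 0 <= psi u) ->
  forall x y x' y', 0 <= x <= x' -> 0 <= y <= y' ->
    value_process Z phi psi n x y -> value_process Z phi psi n x' y'.
Proof.
  intros [_ Hd] Hphi Hpsi. induction n as [|n IH]; intros x y x' y' Hx Hy; simpl; [auto|].
  intros [H | H]; [left; eauto|]. right. intros (r & c & Hr & Hc & HZ). apply H.
  edestruct (leb1_subset (fun u => 0 <= u /\ value_process Z phi psi n x (psi u))) as [r' [Hr' Hle1]];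
    [|exact Hr|].
  { intros u [Hu Hv]. split; [exact Hu|]. revert Hv. apply IH; [lra|]. specialize (Hpsi u). lra. }
  edestruct (leb1_subset (fun v => 0 <= v /\ value_process Z phi psi n (phi v) y)) as [c' [Hc' Hle2]];
    [|exact Hc|].
  { intros v [Hv Hu]. split; [exact Hv|]. revert Hu. apply IH; [|lra]. specialize (Hphi v). lra. }
  exists r', c'. split; [exact Hr'|]. split; [exact Hc'|].
  apply leb1_nonneg in Hr'. apply leb1_nonneg in Hc'.
  eapply Hd; [exact HZ | lra | lra].
Qed.

(** * Comparison of the planar growth with the value process *)

Definition bounds_lines (L : R -> R -> Prop) (f phi : R -> R) : Prop :=
  forall v, 0 <= v -> exists l,
    Forall proper_int l /\ int_cover l (L v) /\ sumR ilen l + f v <= phi v.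

(** A row of the iterate is covered by the row of [A], of length at most [phi v - f v], and a slice
    of the value process; columns behave alike. What [A] contributes is thus already paid for in
    [phi] and [psi], and the planar pair is coordinatewise at most the pair of the value process. *)
Lemma Titer_value_process Z f g A phi psi n :
  downset Z -> (forall p, A p -> quadrant p) ->
  (forall x, 0 <= x -> 0 <= f x) -> (forall x, 0 <= x -> 0 <= g x) ->
  bounds_lines (fun v x => A (x, v)) f phi -> bounds_lines (fun u y => A (u, y)) g psi ->
  forall p, Titer Z f g n A p -> A p \/ value_process Z phi psi n (phi (snd p)) (psi (fst p)).
Proof.
  intros [_ Hd] HA Hf Hg Hrow Hcol. induction n as [|n IH]; intros p; [simpl; auto|].
  intros [Hp | [[Hq1 Hq2] Hp]].
  { destruct (IH p Hp); [left | right; left]; assumption. }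
  right. right. intros (r & c & Hr & Hc & HZ). apply Hp.
  destruct (Hrow _ Hq2) as (l1 & Hl1 & Hc1 & Hs1).
  destruct (Hcol _ Hq1) as (l2 & Hl2 & Hc2 & Hs2).
  destruct (leb1_list_union _ (row_set p (Titer Z f g n A)) l1 r Hl1 Hr) as [r' [Hr' Hle1]].
  { intros x Hx. assert (Hx0 : 0 <= x) by apply (Titer_quadrant _ _ _ _ _ HA _ Hx).
    apply IH in Hx. destruct Hx as [Hx | Hx]; [left; now apply Hc1 | right; auto]. }
  destruct (leb1_list_union _ (col_set p (Titer Z f g n A)) l2 c Hl2 Hc) as [c' [Hc' Hle2]].
  { intros y Hy. assert (Hy0 : 0 <= y) by apply (Titer_quadrant _ _ _ _ _ HA _ Hy).
    apply IH in Hy. destruct Hy as [Hy | Hy]; [left; now apply Hc2 | right; auto]. }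
  exists r', c'. split; [exact Hr'|]. split; [exact Hc'|].
  apply leb1_nonneg in Hr'. apply leb1_nonneg in Hc'.
  specialize (Hf _ Hq2). specialize (Hg _ Hq1).
  eapply Hd; [exact HZ | lra | lra].
Qed.

(** The passage back to the plane: the value process of [phi], [psi] is evaluated at the values of
    [f], [g]. Its slices are up-closed, so [dominates] makes the rows and columns produced by [f],
    [g] at least as long as those the process measures. *)
Lemma value_process_Titer Z phi psi f g n :
  downset Z -> (forall v, 0 <= phi v) -> (forall u, 0 <= psi u) ->
  (forall x, 0 <= x -> 0 <= f x) -> (forall x, 0 <= x -> 0 <= g x) ->
  dominates f phi -> dominates g psi ->
  forall p, quadrant p -> value_process Z phi psi n (f (snd p)) (g (fst p)) ->
    Titer Z f g n empty_set p.
Proof.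
  intros Hdown Hphi Hpsi Hf Hg Hdf Hdg.
  induction n as [|n IH]; intros p Hq; [intros []|].
  intros [H | H]; [left; auto|]. right. split; [exact Hq|].
  intros (r & c & Hr & Hc & HZ). apply H. destruct Hq as [Hq1 Hq2].
  assert (Hf0 := Hf _ Hq2). assert (Hg0 := Hg _ Hq1).
  assert (Hup := value_process_upclosed Z phi psi n Hdown Hphi Hpsi).
  edestruct (leb1_subset
    (fun u => 0 <= u /\ value_process Z phi psi n (f (snd p)) (g u))) as [r1 [Hr1 Hle1]];
    [|exact Hr|].
  { intros u [Hu Hv]. apply IH; [split; simpl; auto | exact Hv]. }
  edestruct (leb1_subset
    (fun v => 0 <= v /\ value_process Z phi psi n (f v) (g (fst p)))) as [c1 [Hc1 Hle2]];
    [|exact Hc|].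
  { intros v [Hv Hu]. apply IH; [split; simpl; auto | exact Hu]. }
  destruct (Hdg (fun y => value_process Z phi psi n (f (snd p)) y)) with (2 := Hr1)
    as [r2 [Hr2 Hle3]].
  { intros y y' Hy. apply Hup; lra. }
  destruct (Hdf (fun x => value_process Z phi psi n x (g (fst p)))) with (2 := Hc1)
    as [c2 [Hc2 Hle4]].
  { intros x x' Hx. apply Hup; lra. }
  exists r2, c2. split; [exact Hr2|]. split; [exact Hc2|].
  apply leb1_nonneg in Hr2. apply leb1_nonneg in Hc2.
  destruct Hdown as [_ Hd]. eapply Hd; [exact HZ | lra | lra].
Qed.

Lemma E_spans_rearranged Z f g A phi psi f' g' :
  downset Z -> (forall p, A p -> quadrant p) -> is_bounded A ->
  (forall x, 0 <= x -> 0 <= f x) -> (forall x, 0 <= x -> 0 <= g x) ->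
  bounds_lines (fun v x => A (x, v)) f phi -> bounds_lines (fun u y => A (u, y)) g psi ->
  (forall v, 0 <= phi v) -> (forall u, 0 <= psi u) ->
  (exists M, forall v, M <= v -> phi v = 0) -> (exists M, forall u, M <= u -> psi u = 0) ->
  (forall x, 0 <= x -> 0 <= f' x) -> (forall x, 0 <= x -> 0 <= g' x) ->
  dominates f' phi -> dominates g' psi ->
  E_spans Z f g A -> E_spans Z f' g' empty_set.
Proof.
  intros Hd HA [M HM] Hf Hg Hrow Hcol Hphi Hpsi [M1 HM1] [M2 HM2] Hf' Hg' Hdf Hdg Hsp.
  set (K := Rmax 0 (Rmax (M + 1) (Rmax M1 M2))).
  assert (HK : 0 <= K /\ M + 1 <= K /\ M1 <= K /\ M2 <= K).
  { unfold K, Rmax. repeat destruct Rle_dec; lra. }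
  destruct HK as (HK0 & HK1 & HK2 & HK3).
  assert (HKq : quadrant (K, K)) by (split; simpl; lra).
  apply Hsp in HKq. destruct HKq as [n Hn].
  apply (Titer_value_process Z f g A phi psi n) in Hn; auto.
  destruct Hn as [Hn | Hn].
  { apply HM in Hn. destruct Hn as [Hn _]. simpl in Hn. apply Rabs_le_between in Hn. lra. }
  (* The point (K, K) lies beyond [A] and both supports, so the process has reached the values (0,
     0) by step [n]. Being up-closed, it has then reached all values, and the same [n] serves every
     point. *)
  simpl in Hn. rewrite HM1, HM2 in Hn by lra.
  apply E_spans_intro; [intros p []|]. intros p Hp. exists n.
  apply (value_process_Titer Z phi psi); auto. destruct Hp as [Hp1 Hp2].
  specialize (Hf' _ Hp2). specialize (Hg' _ Hp1).
  eapply value_process_upclosed; [auto | auto | auto | | | exact Hn]; lra.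
Qed.

(** * Finite rectangle covers of hypographs and the step functions they define *)

Lemma infinite_sum_scal u s k : 0 < k -> infinite_sum u s ->
  infinite_sum (fun n => k * u n) (k * s).
Proof.
  intros Hk H eps He. destruct (H (eps / k)) as [N HN]; [now apply Rdiv_lt_0_compat|].
  exists N. intros n Hn. specialize (HN n Hn). unfold Rdist in *.
  rewrite (sum_eq _ (fun i => u i * k)) by (intros; ring). rewrite <- scal_sum.
  rewrite <- Rmult_minus_distr_l, Rabs_mult, (Rabs_pos_eq k) by lra.
  apply (Rmult_lt_compat_l k) in HN; [|exact Hk].
  replace (k * (eps / k)) with eps in HN by (field; lra). exact HN.
Qed.

(** Unlike [subgraph] it contains the graph and is cut off at [M], hence is compact for admissible
    [f]. *)
Definition hypograph (f : R -> R) (M : R) : pt -> Prop :=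
  fun p => 0 <= fst p <= M /\ 0 <= snd p <= f (fst p).

Lemma hypograph_compact f M : admissible f -> is_compact (hypograph f M).
Proof.
  intros (Hf1 & Hf2 & Hf3 & _). split.
  - intros [x y] H. simpl in *.
    assert (Hb : 0 <= x <= M /\ 0 <= y).
    { repeat split; apply Rnot_lt_le; intros Hn.
      - destruct (H (- x)) as [q [[Hq1 Hq2] [H1 H2]]]; [lra|].
        simpl in *. apply Rabs_def2 in H1. lra.
      - destruct (H (x - M)) as [q [[Hq1 Hq2] [H1 H2]]]; [lra|].
        simpl in *. apply Rabs_def2 in H1. lra.
      - destruct (H (- y)) as [q [[Hq1 Hq2] [H1 H2]]]; [lra|].
        simpl in *. apply Rabs_def2 in H2. lra. }
    split; simpl; [lra|]. split; [lra|]. apply Rnot_lt_le. intros Hlt.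
    set (e := (y - f x) / 2). assert (He : 0 < e) by (unfold e; lra).
    (* Upper semicontinuity at [x]: monotonicity controls the points to the right, left continuity
       those to the left, of which there are none when x = 0. *)
    assert (Hd : exists d, 0 < d /\ forall x', 0 <= x' -> x - d < x' -> f x' < f x + e).
    { destruct (Rle_dec x 0) as [Hx|Hx].
      - exists 1. split; [lra|]. intros x' Hx' _. specialize (Hf2 x x' ltac:(lra)). lra.
      - destruct (Hf3 x ltac:(lra) e He) as [d [Hd Hfd]]. exists d. split; [exact Hd|].
        intros x' Hx' Hxd. destruct (Rle_dec x' x) as [Hle|Hgt].
        + specialize (Hfd x' Hx' ltac:(lra)). apply Rabs_def2 in Hfd. lra.
        + specialize (Hf2 x x' ltac:(lra)). lra. }
    destruct Hd as [d [Hd Hfd]].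
    destruct (H (Rmin d e)) as [[x' y'] [[Hq1 Hq2] [H1 H2]]]; [now apply Rmin_glb_lt|].
    simpl in *. assert (Rmin d e <= d) by apply Rmin_l. assert (Rmin d e <= e) by apply Rmin_r.
    apply Rabs_def2 in H1. apply Rabs_def2 in H2.
    specialize (Hfd x' ltac:(lra) ltac:(lra)). unfold e in *. lra.
  - exists (M + f 0). intros [x y] [Hx Hy]. simpl in *.
    specialize (Hf2 0 x ltac:(lra)). rewrite !Rabs_pos_eq; lra.
Qed.

(* Stretching the subgraph vertically by a factor [k > 1] covers the graph itself. *)
Lemma cover_sums2_hypograph f M s k : 0 <= M -> 1 < k ->
  cover_sums2 (subgraph f) s -> cover_sums2 (hypograph f M) (k * s).
Proof.
  intros HM Hk (a & b & c & d & Hab & Hc & Hs).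
  (* A degenerate rectangle for the base line: where [f] vanishes, the fibre of the subgraph is
     empty and stretching it produces nothing. *)
  set (r := ((0, M), (0, 0)) : rect).
  replace (k * s) with (area r + k * s) by (unfold area, ilen; simpl; ring).
  set (S := fun p => subgraph f (fst p, snd p / k)).
  apply (cover_sums2_subset _ (fun p => in_rect r p \/ S p)).
  - intros [x y] [Hx Hy]. simpl in *. destruct (Rle_dec y 0) as [Hy0|Hy0].
    + left. unfold in_rect, in_int; simpl. lra.
    + right. unfold S, subgraph; simpl. assert (y / k < y).
      { apply (Rmult_lt_reg_r k); [lra|]. replace (y / k * k) with y by (field; lra). nra. }
      assert (0 <= y / k) by (apply Rdiv_le_0_compat; lra). lra.
  - apply cover_sums2_cons; [unfold proper_rect, proper_int; simpl; lra|].
    exists a, b, (fun n => k * c n), (fun n => k * d n). split; [|split].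
    + intros n. destruct (Hab n) as [H1 H2]. split; [exact H1|].
      apply Rmult_le_compat_l; lra.
    + intros [x y] Hp. destruct (Hc _ Hp) as [n [H1 H2]]. exists n. simpl in *.
      split; [exact H1|].
      replace y with (k * (y / k)) by (field; lra).
      split; apply Rmult_le_compat_l; lra.
    + eapply infinite_sum_ext; [|apply infinite_sum_scal with (2 := Hs) (k := k); lra].
      intros n; simpl; ring.
Qed.

Definition rswap (r : rect) : rect := (snd r, fst r).
(** A rectangle as seen by horizontal lines: its width, carried by its range of heights, so that the
    mass is the area. Composed with [rswap] it describes vertical lines. *)
Definition row_weight (r : rect) : R * interval := (ilen (fst r), snd r).

Lemma row_weight_proper L : Forall proper_rect L -> Forall proper_bump (map row_weight L).
Proof.
  intros H. apply Forall_map. revert H. apply Forall_impl. intros r [H1 H2].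
  split; [unfold proper_int, row_weight, ilen in *; simpl; lra | exact H2].
Qed.

Lemma rswap_proper L : Forall proper_rect L -> Forall proper_rect (map rswap L).
Proof. intros H. apply Forall_map. revert H. apply Forall_impl. intros r [H1 H2]. now split. Qed.

Lemma mass_row_weight L : mass (map row_weight L) = sumR area L.
Proof. unfold mass. rewrite sumR_map. reflexivity. Qed.

Lemma area_rswap L : sumR area (map rswap L) = sumR area L.
Proof. rewrite sumR_map. apply sumR_ext. intros r. unfold area, rswap; simpl. ring. Qed.

Lemma simple_app l1 l2 v : simple (l1 ++ l2) v = simple l1 v + simple l2 v.
Proof. apply sumR_app. Qed.

Lemma rect_row_slices L v : Forall proper_rect L ->
  exists l, Forall proper_int l /\ sumR ilen l = simple (map row_weight L) v /\
    int_cover l (fun x => exists r, In r L /\ in_rect r (x, v)).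
Proof.
  induction L as [|r L IH]; intros HL.
  - exists []. split; [constructor|]. split; [reflexivity|]. intros x [r [[] _]].
  - inversion HL as [|? ? Hr HL']; subst. destruct (IH HL') as (l & Hl & Hs & Hc).
    unfold simple in *; simpl. unfold bump at 1. simpl.
    destruct (classic (in_int (snd r) v)) as [Hv|Hv].
    + exists (fst r :: l). split; [constructor; [apply Hr | exact Hl]|]. split.
      * simpl. rewrite Hs. destruct Hv. repeat destruct Rle_dec; lra.
      * intros x [r' [[<-|Hin] Hx]].
        -- exists (fst r). split; [now left | apply Hx].
        -- destruct (Hc x) as [i [Hi Hxi]]; [eauto|]. exists i. split; [now right | exact Hxi].
    + exists l. split; [exact Hl|]. split.
      * rewrite Hs. destruct Rle_dec; [|ring]. destruct Rle_dec; [|ring].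
        exfalso. apply Hv. now split.
      * intros x [r' [[<-|Hin] Hx]]; [exfalso; apply Hv, Hx | apply Hc; eauto].
Qed.

Lemma in_rect_rswap L x y :
  (exists r, In r L /\ in_rect r (x, y)) ->
  exists r, In r (map rswap L) /\ in_rect r (y, x).
Proof.
  intros [r [Hr [H1 H2]]]. exists (rswap r). split; [now apply in_map | now split].
Qed.

(** The value [f v] is the length of the vertical fibre of the hypograph over [v], and a finite
    interval cover of that fibre cannot be shorter. The thirds of [eps] pay for a near-optimal
    cover, the stretching and the finite selection. *)
Lemma finite_hypograph_cover f iF eps :
  admissible f -> leb2 (subgraph f) (Some iF) -> 0 < eps ->
  exists L, Forall proper_rect L /\ sumR area L <= iF + eps /\
    forall v, 0 <= v -> f v <= simple (map row_weight (map rswap L)) v.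
Proof.
  intros Hf HiF He.
  destruct (Hf) as (Hf1 & _ & _ & [M0 HM0]).
  set (M := Rmax 0 M0). assert (0 <= M) by apply Rmax_l. assert (M0 <= M) by apply Rmax_r.
  destruct (is_inf_approx _ _ (eps / 3) HiF) as [s [Hs Hs']]; [lra|].
  assert (Hs0 := cover_sums2_nonneg _ _ Hs).
  assert (Ht : exists t, 0 < t /\ t * s <= eps / 3).
  { exists (eps / 3 / (s + 1)). split; [apply Rdiv_lt_0_compat; lra|].
    apply (Rmult_le_reg_r (s + 1)); [lra|].
    replace (eps / 3 / (s + 1) * s * (s + 1)) with (eps / 3 * s) by (field; lra). nra. }
  destruct Ht as [t [Ht Hts]].
  destruct (leb2_of_cover (hypograph f M) ((1 + t) * s)) as [h [Hh Hhs]].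
  { apply cover_sums2_hypograph; [assumption | lra | exact Hs]. }
  destruct (finite_rect_cover (hypograph f M) h (eps / 3)) as (L & HL & Hc & HLs);
    [now apply hypograph_compact | exact Hh | lra |].
  exists L. split; [exact HL|]. split; [lra|].
  intros v Hv. assert (HL' := rswap_proper L HL).
  destruct (Rle_dec v M) as [HvM|HvM].
  - destruct (rect_row_slices (map rswap L) v HL') as (l & Hl & Hsum & Hcl).
    rewrite <- Hsum. replace (f v) with (f v - 0) by ring.
    apply finite_int_cover_length; [exact Hl|]. intros y Hy. apply Hcl.
    apply in_rect_rswap. apply Hc. split; simpl; lra.
  - rewrite HM0 by lra. apply simple_nonneg. now apply row_weight_proper.
Qed.

Lemma bounds_lines_rects L L' (A : pt -> Prop) f :
  Forall proper_rect L -> rect_cover L A ->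
  (forall v, 0 <= v -> f v <= simple (map row_weight L') v) ->
  bounds_lines (fun v x => A (x, v)) f (simple (map row_weight (L ++ L'))).
Proof.
  intros HL Hc Hf v Hv. destruct (rect_row_slices L v HL) as (l & Hl & Hs & Hcl).
  exists l. split; [exact Hl|]. split; [intros x Hx; apply Hcl, Hc, Hx|].
  rewrite map_app, simple_app, Hs. specialize (Hf v Hv). lra.
Qed.

(** The cover of [A] enters both [L1] and [L2], those of [f] and [g] one each. This leaves six
    errors of eps / 8: four from covers, that of [A] counted twice, and two from the
    rearrangements. *)
Lemma spanning_strips_exist Z x eps :
  downset Z -> I_values 0 0 Z x -> 0 < eps ->
  exists f g iF iG, admissible f /\ admissible g /\ E_spans Z f g empty_set /\
    leb2 (subgraph f) (Some iF) /\ leb2 (subgraph g) (Some iG) /\ iF + iG <= 2 * x + eps.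
Proof.
  intros Hd (A & f & g & aA & iF & iG & Hf & Hg & HA & HAq & Hsp & HaA & HiF & HiG & Hx) He.
  destruct (finite_rect_cover A aA (eps / 8)) as (LA & HLA & HcA & HsA); [auto | auto | lra |].
  destruct (finite_hypograph_cover f iF (eps / 8)) as (LF & HLF & HsF & HcF); [auto | auto | lra |].
  destruct (finite_hypograph_cover g iG (eps / 8)) as (LG & HLG & HsG & HcG); [auto | auto | lra |].
  set (L1 := LA ++ map rswap LF). set (L2 := map rswap LA ++ map rswap LG).
  assert (HL1 : Forall proper_bump (map row_weight L1)).
  { apply row_weight_proper, Forall_app. split; [exact HLA | now apply rswap_proper]. }
  assert (HL2 : Forall proper_bump (map row_weight L2)).
  { apply row_weight_proper, Forall_app. split; now apply rswap_proper. }
  destruct (rearrangement_exists _ (eps / 8) HL1) as (f' & iF' & Hf' & HiF' & HsF' & Hdf); [lra|].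
  destruct (rearrangement_exists _ (eps / 8) HL2) as (g' & iG' & Hg' & HiG' & HsG' & Hdg); [lra|].
  rewrite mass_row_weight in HsF', HsG'. unfold L1, L2 in HsF', HsG'.
  rewrite sumR_app, area_rswap in HsF'. rewrite sumR_app, !area_rswap in HsG'.
  exists f', g', iF', iG'. split; [exact Hf'|]. split; [exact Hg'|]. split.
  - apply (E_spans_rearranged Z f g A (simple (map row_weight L1)) (simple (map row_weight L2)));
      auto.
    + apply HA.
    + apply Hf.
    + apply Hg.
    + now apply bounds_lines_rects.
    + apply (bounds_lines_rects _ _ (swap_set A)); [now apply rswap_proper | | exact HcG].
      intros [y u] Hp. apply in_rect_rswap, HcA, Hp.
    + intros v. now apply simple_nonneg.
    + intros u. now apply simple_nonneg.
    + apply simple_support.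
    + apply simple_support.
    + apply Hf'.
    + apply Hg'.
  - split; [exact HiF'|]. split; [exact HiG'|].
    apply leb2_nonneg in HiF. apply leb2_nonneg in HiG. lra.
Qed.

(** * Values for truncated zero-sets and their limit *)

Lemma I_values_strips alpha beta Z f g iF iG :
  admissible f -> admissible g -> E_spans Z f g empty_set ->
  leb2 (subgraph f) (Some iF) -> leb2 (subgraph g) (Some iG) ->
  I_values alpha beta Z ((1 - alpha) * iF + (1 - beta) * iG).
Proof.
  intros Hf Hg Hsp HiF HiG. exists empty_set, f, g, 0, iF, iG.
  repeat (split; [first [assumption | apply empty_compact | intros p [] | now apply leb2_null]|]).
  ring.
Qed.

Lemma swap_closed S : is_closed S -> is_closed (swap_set S).
Proof.
  intros H p Hp. apply H. intros eps He. destruct (Hp eps He) as [q [Hq [H1 H2]]].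
  exists (swap q). split; [exact Hq | now split].
Qed.

Lemma swap_bounded S : is_bounded S -> is_bounded (swap_set S).
Proof. intros [M HM]. exists M. intros p Hp. apply HM in Hp. destruct Hp. now split. Qed.

Lemma swap_downset S : downset S -> downset (swap_set S).
Proof.
  intros [H1 H2]. split.
  - intros p Hp. apply H1 in Hp. destruct Hp. now split.
  - intros a b u v Hab Hu Hv. exact (H2 b a v u Hab Hv Hu).
Qed.

(** The strip uses whichever of [f], [g] has the smaller weight, 1 - max(alpha, beta); reflection
    reduces the case of [g] to that of [f]. *)
Lemma I_values_area alpha beta Z s eps :
  is_compact Z -> downset Z -> cover_sums2 Z s ->
  0 <= alpha <= 1 -> 0 <= beta <= 1 -> 0 < eps ->
  exists x, I_values alpha beta Z x /\ x <= (1 - Rmax alpha beta) * s + eps.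
Proof.
  intros HZ Hd Hs Ha Hb He. destruct (Rle_dec alpha beta) as [Hab|Hab].
  - destruct (row_strip_exists (swap_set Z) s eps) as (g & iG & Hg & Hsp & HiG & Hle); auto.
    + destruct HZ. split; [now apply swap_closed | now apply swap_bounded].
    + now apply swap_downset.
    + now apply cover_sums2_swap.
    + eexists. split.
      * eapply I_values_strips; [exact admissible_zero | exact Hg | | | exact HiG].
        -- now apply E_spans_swap.
        -- exact leb2_subgraph_zero.
      * rewrite Rmax_right by exact Hab. nra.
  - destruct (row_strip_exists Z s eps) as (f & iF & Hf & Hsp & HiF & Hle); auto.
    eexists. split.
    + eapply I_values_strips; [exact Hf | exact admissible_zero | exact Hsp | exact HiF |].
      exact leb2_subgraph_zero.
    + rewrite Rmax_left by lra. nra.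
Qed.

Lemma I_values_nonneg alpha beta Z x :
  alpha <= 1 -> beta <= 1 -> I_values alpha beta Z x -> 0 <= x.
Proof.
  intros Ha Hb (A & f & g & aA & iF & iG & _ & _ & _ & _ & _ & HA & HF & HG & ->).
  apply leb2_nonneg in HA. apply leb2_nonneg in HF. apply leb2_nonneg in HG.
  assert (0 <= (1 - alpha) * iF) by (apply Rmult_le_pos; lra).
  assert (0 <= (1 - beta) * iG) by (apply Rmult_le_pos; lra). lra.
Qed.

Lemma I_values_zero_mono alpha beta Z Z' x :
  (forall p, Z p -> Z' p) -> downset Z' -> I_values alpha beta Z' x -> I_values alpha beta Z x.
Proof.
  intros HZ HZ' (A & f & g & aA & iF & iG & Hf & Hg & HA & HAq & Hsp & Hrest).
  exists A, f, g, aA, iF, iG. repeat (split; [assumption|]). split; [|exact Hrest].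
  eapply E_spans_zero_mono; eauto; [apply Hf | apply Hg].
Qed.

Lemma truncate_compact Z r : zero_set Z -> is_compact (truncate Z r).
Proof.
  intros (Hcl & Hq & _). split.
  - intros p H. split; [|split].
    + apply Hcl. intros eps He. destruct (H eps He) as [q [[Hq1 _] Hn]]. eauto.
    + apply Rnot_lt_le. intros Hn. destruct (H (fst p - r)) as [q [[_ [H1 _]] [H2 _]]]; [lra|].
      apply Rabs_def2 in H2. lra.
    + apply Rnot_lt_le. intros Hn. destruct (H (snd p - r)) as [q [[_ [_ H1]] [_ H2]]]; [lra|].
      apply Rabs_def2 in H2. lra.
  - exists r. intros p [Hp [H1 H2]]. apply Hq in Hp. destruct Hp as [Hp1 Hp2].
    rewrite !Rabs_pos_eq by assumption. auto.
Qed.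

Lemma truncate_downset Z r : zero_set Z -> downset (truncate Z r).
Proof.
  intros (_ & Hq & Hd & _). split.
  - intros p [Hp _]. auto.
  - intros a b u v [Hab [H1 H2]] Hu Hv. simpl in *.
    split; [eapply Hd; eauto | simpl; lra].
Qed.

(** The strips of the area bound show that the infimum is over a nonempty set. A cover of [Z] covers
    every truncation, so the bound is uniform in [r]. *)
Lemma I_bounded_exists alpha beta Z r areaZ :
  zero_set Z -> leb2 Z (Some areaZ) -> 0 <= alpha <= 1 -> 0 <= beta <= 1 ->
  exists v, I_bounded alpha beta (truncate Z r) v /\ 0 <= v <= (1 - Rmax alpha beta) * areaZ.
Proof.
  intros HZ Harea Ha Hb.
  assert (Hmax : 0 <= 1 - Rmax alpha beta <= 1).
  { unfold Rmax. destruct Rle_dec; lra. }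
  assert (Happ : forall eps, 0 < eps -> exists x, I_values alpha beta (truncate Z r) x /\
            x <= (1 - Rmax alpha beta) * areaZ + eps).
  { intros eps He. destruct (is_inf_approx _ _ (eps / 2) Harea) as [s [Hs Hlt]]; [lra|].
    destruct (I_values_area alpha beta (truncate Z r) s (eps / 2)) as [x [Hx Hle]]; auto.
    - now apply truncate_compact.
    - now apply truncate_downset.
    - eapply cover_sums2_subset; [|exact Hs]. now intros p [Hp _].
    - lra.
    - exists x. split; [exact Hx|]. nra. }
  destruct (is_inf_exists (I_values alpha beta (truncate Z r))) as [v Hv].
  - destruct (Happ 1) as [x [Hx _]]; [lra | eauto].
  - intros x. apply I_values_nonneg; lra.
  - exists v. split; [exact Hv|]. split.
    + apply Hv. intros x. apply I_values_nonneg; lra.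
    + apply Rnot_lt_le. intros Hlt.
      destruct (Happ ((v - (1 - Rmax alpha beta) * areaZ) / 2)) as [x [Hx Hle]]; [lra|].
      apply Hv in Hx. lra.
Qed.

Lemma I_tilde_is_sup alpha beta Z areaZ :
  zero_set Z -> leb2 Z (Some areaZ) -> 0 <= alpha <= 1 -> 0 <= beta <= 1 ->
  exists I, I_tilde alpha beta Z I /\
    is_lub (fun v => exists r, I_bounded alpha beta (truncate Z r) v) I.
Proof.
  intros HZ Harea Ha Hb.
  assert (Huniq : forall r v w, I_bounded alpha beta (truncate Z r) v ->
            I_bounded alpha beta (truncate Z r) w -> v <= w).
  { intros r v w Hv Hw. apply Hw. intros x Hx. now apply Hv. }
  assert (Hmono : forall r r' v w, r <= r' -> I_bounded alpha beta (truncate Z r) v ->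
            I_bounded alpha beta (truncate Z r') w -> v <= w).
  { intros r r' v w Hr Hv Hw. apply Hw. intros x Hx. apply Hv.
    eapply I_values_zero_mono; [|apply (truncate_downset _ r' HZ) | exact Hx].
    intros p [Hp Hpr]. split; [exact Hp | lra]. }
  destruct (completeness (fun v => exists r, I_bounded alpha beta (truncate Z r) v)) as [I HI].
  - exists ((1 - Rmax alpha beta) * areaZ). intros v [r Hv].
    destruct (I_bounded_exists alpha beta Z r areaZ) as [w [Hw Hwle]]; auto.
    specialize (Huniq _ _ _ Hv Hw). lra.
  - destruct (I_bounded_exists alpha beta Z 0 areaZ) as [w [Hw _]]; eauto.
  - exists I. split; [|exact HI]. intros eps He.
    assert (Hclose : exists r v, I_bounded alpha beta (truncate Z r) v /\ I - eps < v).
    { apply NNPP. intros Hn. assert (I <= I - eps); [|lra].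
      apply HI. intros v [r Hv]. apply Rnot_lt_le. intros Hlt. apply Hn. eauto. }
    destruct Hclose as (r0 & v0 & Hv0 & Hlt). exists r0. intros r Hr.
    destruct (I_bounded_exists alpha beta Z r areaZ) as [v [Hv _]]; auto.
    exists v. split; [exact Hv|].
    specialize (Hmono _ _ _ _ Hr Hv0 Hv).
    assert (v <= I) by (apply HI; eauto). apply Rabs_def1; lra.
Qed.

(** * Comparison with the value at (0, 0) *)

Lemma I_bounded_le_gamma alpha beta Z v w :
  0 <= alpha <= 1 -> 0 <= beta <= 1 ->
  I_bounded alpha beta Z v -> I_bounded 0 0 Z w -> v <= w.
Proof.
  intros Ha Hb Hv Hw. apply Hw.
  intros x (A & f & g & aA & iF & iG & Hf & Hg & HA & HAq & Hsp & HaA & HiF & HiG & ->).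
  apply Rle_trans with (aA + (1 - alpha) * iF + (1 - beta) * iG).
  - apply Hv. exists A, f, g, aA, iF, iG. repeat (split; [assumption|]). reflexivity.
  - apply leb2_nonneg in HiF. apply leb2_nonneg in HiG. nra.
Qed.

(** Each of the weights 1, 1 - alpha, 1 - beta is at least 1 - max(alpha, beta), so the cost of a
    triple is at least that multiple of its cost at (0, 0). *)
Lemma I_bounded_ge_gamma alpha beta Z v w :
  0 <= alpha <= 1 -> 0 <= beta <= 1 ->
  I_bounded alpha beta Z v -> I_bounded 0 0 Z w -> (1 - Rmax alpha beta) * w <= v.
Proof.
  intros Ha Hb Hv Hw. apply Hv.
  intros x (A & f & g & aA & iF & iG & Hf & Hg & HA & HAq & Hsp & HaA & HiF & HiG & ->).
  assert (Hle : w <= aA + (1 - 0) * iF + (1 - 0) * iG).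
  { apply Hw. exists A, f, g, aA, iF, iG. repeat (split; [assumption|]). reflexivity. }
  apply leb2_nonneg in HaA. apply leb2_nonneg in HiF. apply leb2_nonneg in HiG.
  assert (alpha <= Rmax alpha beta) by apply Rmax_l.
  assert (beta <= Rmax alpha beta) by apply Rmax_r.
  assert (Rmax alpha beta <= 1) by (apply Rmax_lub; lra).
  set (m := Rmax alpha beta) in *.
  assert ((1 - m) * w <= (1 - m) * (aA + iF + iG)) by (apply Rmult_le_compat_l; lra).
  nra.
Qed.

Lemma I_bounded_le_twice_gamma alpha beta Z v w :
  downset Z -> 0 <= alpha <= 1 -> 0 <= beta <= 1 ->
  I_bounded alpha beta Z v -> I_bounded 0 0 Z w -> v <= 2 * (1 - Rmin alpha beta) * w.
Proof.
  intros Hd Ha Hb Hv Hw.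
  assert (Hma : Rmin alpha beta <= alpha) by apply Rmin_l.
  assert (Hmb : Rmin alpha beta <= beta) by apply Rmin_r.
  assert (Hm0 : 0 <= Rmin alpha beta) by (apply Rmin_glb; lra).
  set (m := Rmin alpha beta) in *.
  apply Rnot_lt_le. intros Hlt.
  (* A quarter of the assumed gap: near-optimality of [x] costs 2e after doubling and the strips
     another e, so only 3e of the 4e are spent. *)
  set (e := (v - 2 * (1 - m) * w) / 4). assert (He : 0 < e) by (unfold e; lra).
  destruct (is_inf_approx _ _ e Hw He) as [x [Hx Hxw]].
  destruct (spanning_strips_exist Z x e Hd Hx He)
    as (f & g & iF & iG & Hf & Hg & Hsp & HiF & HiG & Hle).
  assert (Hvle := proj1 Hv _ (I_values_strips alpha beta Z f g iF iG Hf Hg Hsp HiF HiG)).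
  apply leb2_nonneg in HiF. apply leb2_nonneg in HiG.
  assert (H1 : (1 - alpha) * iF + (1 - beta) * iG <= (1 - m) * (iF + iG)) by nra.
  assert (H2 : (1 - m) * (iF + iG) <= (1 - m) * (2 * w + 3 * e)) by (apply Rmult_le_compat_l; lra).
  assert (H3 : (1 - m) * (3 * e) <= 3 * e) by nra.
  unfold e in *. lra.
Qed.

Theorem mainTheorem5 :
  forall (Z : pt -> Prop) (areaZ : R),
    zero_set Z -> leb2 Z (Some areaZ) ->
  forall alpha beta : R, 0 <= alpha <= 1 -> 0 <= beta <= 1 ->
  exists I G : R,
    I_tilde alpha beta Z I /\ gamma_tilde Z G /\
    (1 - Rmax alpha beta) * G <= I /\
    I <= Rmin ((1 - Rmax alpha beta) * areaZ)
              (Rmin (2 * (1 - Rmin alpha beta) * G) G).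
Proof.
  intros Z areaZ HZ Harea alpha beta Ha Hb.
  assert (H0 : 0 <= 0 <= 1) by lra.
  destruct (I_tilde_is_sup alpha beta Z areaZ) as [I [HI HIsup]]; auto.
  destruct (I_tilde_is_sup 0 0 Z areaZ) as [G [HG HGsup]]; auto.
  assert (HexI := fun r => I_bounded_exists alpha beta Z r areaZ HZ Harea Ha Hb).
  assert (HexG := fun r => I_bounded_exists 0 0 Z r areaZ HZ Harea H0 H0).
  exists I, G. split; [exact HI|]. split; [exact HG|]. split.
  - assert (Hmax : Rmax alpha beta <= 1) by (apply Rmax_lub; lra).
    assert (HI0 : 0 <= I).
    { destruct (HexI 0) as [v [Hv Hv0]]. assert (v <= I) by (apply HIsup; eauto). lra. }
    (* For maximum 1 the claim reads 0 <= I. Otherwise division turns the bound at each radius into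
       an upper bound for the supremum [G]. *)
    destruct (Req_dec (Rmax alpha beta) 1) as [->|Hne]; [lra|].
    assert (Hpos : 0 < 1 - Rmax alpha beta) by lra.
    assert (HGle : G <= I / (1 - Rmax alpha beta)).
    { apply HGsup. intros w [r Hw]. destruct (HexI r) as [v [Hv _]].
      assert (v <= I) by (apply HIsup; eauto).
      assert (Hge := I_bounded_ge_gamma _ _ _ _ _ Ha Hb Hv Hw).
      apply (Rmult_le_reg_l (1 - Rmax alpha beta)); [exact Hpos|].
      replace ((1 - Rmax alpha beta) * (I / (1 - Rmax alpha beta))) with I by (field; lra). lra. }
    apply (Rmult_le_compat_l (1 - Rmax alpha beta)) in HGle; [|lra].
    replace ((1 - Rmax alpha beta) * (I / (1 - Rmax alpha beta))) with I in HGle by (field; lra).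
    exact HGle.
  - apply HIsup. intros v [r Hv].
    destruct (HexG r) as [w [Hw _]]. assert (HwG : w <= G) by (apply HGsup; eauto).
    repeat apply Rmin_glb.
    + destruct (HexI r) as [v' [Hv' Hle]].
      assert (v <= v') by (apply Hv'; intros x Hx; now apply Hv). lra.
    + assert (Hle := I_bounded_le_twice_gamma _ _ _ _ _ (truncate_downset Z r HZ) Ha Hb Hv Hw).
      assert (Rmin alpha beta <= alpha) by apply Rmin_l.
      eapply Rle_trans; [exact Hle|]. apply Rmult_le_compat_l; lra.
    + assert (Hle := I_bounded_le_gamma _ _ _ _ _ Ha Hb Hv Hw). lra.
Qed.
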